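(* Fix $j\in\mathbb N$ and write $\phi=\phi_j$, $\lambda=\lambda_j$. The function $x\mapsto x^{-1}\phi(x)$ is Lebesgue integrable on $[0,1]$; put $\Phi_1=\int_0^1\frac{\phi(y)}{y}\,dy\in\mathbb R$. If $0<x<1$ and $1/x$ is not an integer, then $\phi$ is differentiable at $x$ and $$\lambda^{-1}x^2\phi'(x)=\Phi_1-\sum_{m>1/x}\frac{\phi\left(\frac{1}{mx}\right)}{m}\in\mathbb R,$$ the sum being over integers $m>1/x$. Moreover, for each $n\in\mathbb N$, the derivative $\phi'$ is continuous on the open interval $\left(\frac1{n+1},\frac1n\right)$, and $$\lim_{x\to\frac1n-}\phi'(x)=\lambda n^2\Big(\Phi_1-\sum_{m=n+1}^\infty\frac{\phi(n/m)}{m}\Big)\in\mathbb R,\qquad \lim_{x\to\frac1{n+1}+}\phi'(x)=\lambda (n+1)^2\Big(\Phi_1-\sum_{m=n+1}^\infty\frac{\phi((n+1)/m)}{m}\Big)\in\mathbb R.$$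
   Context: Let $K:[0,1]\times[0,1]\to\mathbb R$ be defined by $K(x,y)=\frac12-\{(xy)^{-1}\}$ if $0<x,y\le 1$, and $K(x,y)=0$ if $0\le x,y\le1$ and $xy=0$, where $\{\alpha\}=\alpha-\lfloor\alpha\rfloor$. Let $L^2([0,1])$ denote the space of real-valued Lebesgue measurable square-integrable functions on $[0,1]$, with $\langle f,g\rangle=\int_0^1 f(x)g(x)\,dx$ and $\|f\|=\langle f,f\rangle^{1/2}$. A function $\phi$ is an eigenfunction of $K$ (with eigenvalue $\lambda\in\mathbb R$) if $\phi\in L^2([0,1])$, $\|\phi\|>0$, and $\phi(x)=\lambda\int_0^1 K(x,y)\phi(y)\,dy$ for every $x\in[0,1]$. Let $\phi_1,\phi_2,\ldots$ be a maximal orthonormal system in $L^2([0,1])$ of eigenfunctions of $K$, $\phi_j$ having the nonzero real eigenvalue $\lambda_j$, numbered so that $0<|\lambda_1|\le|\lambda_2|\le\cdots$ and $\lambda_j\ge\lambda_{j+1}$ whenever $|\lambda_j|=|\lambda_{j+1}|$. *)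

(* Defs.v *)
From HB Require Import structures.
From mathcomp Require Import all_boot all_order all_algebra.
From mathcomp Require Import all_classical all_reals all_analysis.
Set Implicit Arguments. Unset Strict Implicit. Unset Printing Implicit Defensive.
Import Order.TTheory GRing.Theory Num.Theory.
Import numFieldNormedType.Exports.
Local Open Scope classical_set_scope.
Local Open Scope ring_scope.

Section Defs.
Variable R : realType.

Definition fracpart (a : R) : R := a - (Num.floor a)%:~R.

(* The kernel K(x,y) = 1/2 - {(xy)^-1} for 0 < x,y <= 1, and 0 if xy = 0.
   (Only its values on [0,1]^2 matter.) *)
Definition Kker (x y : R) : R :=
  if (x * y != 0) then 2^-1 - fracpart ((x * y)^-1) else 0.

Local Notation leb := (@lebesgue_measure R).

Definition I01 : set R := `[0%R, 1%R].

Definition inL2 (f : R -> R) : Prop :=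
  measurable_fun I01 f /\
  leb.-integrable I01 (fun x => ((f x) ^+ 2)%:E).

Definition ip (f g : R -> R) : R := \int[leb]_(x in I01) (f x * g x).

Definition eigenfun (phi : R -> R) (lam : R) : Prop :=
  inL2 phi /\ 0 < ip phi phi /\
  forall x, I01 x ->
    phi x = lam * \int[leb]_(y in I01) (Kker x y * phi y).

(* phi_1, phi_2, ... (indexed here from 0: phi 0 = phi_1) is a maximal
   orthonormal system of eigenfunctions of K with nonzero real eigenvalues
   lam, numbered as in the paper. *)
Definition eigen_system (phi : nat -> R -> R) (lam : nat -> R) : Prop :=
  (forall j, lam j != 0 /\ eigenfun (phi j) (lam j)) /\
  (forall i j, ip (phi i) (phi j) = (i == j)%:R) /\
  (forall (psi : R -> R) (mu : R), mu != 0 -> eigenfun psi mu ->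
     ip psi psi = 1 -> ~ (forall j, ip psi (phi j) = 0)) /\
  (forall j, 0 < `|lam j| <= `|lam j.+1|) /\
  (forall j, `|lam j| = `|lam j.+1| -> lam j.+1 <= lam j).

End Defs.

(* Main.v *)
Require Import Defs.
From HB Require Import structures.
From mathcomp Require Import all_boot all_order all_algebra.
From mathcomp Require Import all_classical all_reals all_analysis.
From mathcomp Require Import measurable_realfun ring lra.
Set Implicit Arguments.
Unset Strict Implicit.
Unset Printing Implicit Defensive.
Import Order.TTheory GRing.Theory Num.Theory.
Import numFieldNormedType.Exports.
Local Open Scope classical_set_scope.
Local Open Scope ring_scope.

(** Write [F t] for the integral of [phi] over [(0, t]].  Summing the indicators
    of [m <= 1 / (x y)] gives
      [phi x / lam = F 1 / 2 - Phi1 / x + \sum_m F (1 / (m x))],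
    which can be differentiated term by term once [phi y = O(y ^ (1/4))]: this
    decay makes [phi y / y] integrable and dominates the series and its
    derivative by [\sum_m m ^ (-5/4)].

    The decay is a bootstrap.  Truncating the identity at [m <= N], where only
    [phi] bounded is needed, yields a modulus of continuity for [phi].  On each
    branch [1/(x(n+1)) < y <= 1/(xn)] of the fractional part the kernel is nearly
    affine with mean zero, so [phi x] is controlled by the oscillation of [phi]
    on these short intervals. *)

(** The kernel is not small for small x, so decay can only come from cancellation over each branch.
    What makes this work is that the modulus of continuity is measured in reciprocals: the ends of a
    branch have reciprocals n x and (n + 1) x, so 1/y changes by at most x across it. Truncating at
    N costs O(1/(N y)) at the point y, the truncated integrals then vary by O(N x) over a branch,
    and the branches below some cut are discarded at a cost proportional to the cut. The choices of
    N and of the cut keep all three losses at O(x^(1/4)). Any positive exponent would serve the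
    later steps. Throughout, [phi] is replaced by its restriction f to (0, 1], extended by zero, so
    that F is constant from 1 on. *)

(** * Dominated series and termwise differentiation *)

Section DominatedSeries.
Context {R : realType}.
Implicit Types (u b l : nat -> R).

(** The bound on the tail involves [b] alone, so it is uniform over any family dominated by [b]. *)
Lemma series_dominated u b : (forall m, `|u m| <= b m) -> cvgn (series b) ->
  cvgn (series u) /\
  forall N, `|limn (series u) - series u N| <= limn (series b) - series b N.
Proof.
move=> ub cb.
have cu : cvgn (series u).
  apply: normed_cvg; apply: series_le_cvg cb => m //=.
  exact: le_trans (ub m).
split=> // N.
have c1 : `|series u n - series u N| @[n --> \oo] -->
    `|limn (series u) - series u N|.
  by apply: cvg_norm; apply: cvgB => //; exact: cvg_cst.
have c2 : series b n - series b N @[n --> \oo] --> limn (series b) - series b N.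
  by apply: cvgB => //; exact: cvg_cst.
apply: (ler_cvg_to c1 c2).
near=> n.
have Nn : (N <= n)%N by near: n; exact: nbhs_infty_ge.
rewrite !sub_series_geq//; apply: (le_trans (ler_norm_sum _ _ _)).
exact: ler_sum.
Unshelve. all: by end_near. Qed.

(** Tannery's theorem along a filter: cut at an N where the tail of [b] is below e/3, and use
    termwise convergence on the finitely many terms left. An arbitrary filter covers punctured, full
    and one-sided neighbourhoods alike. *)
Lemma cvg_series_dominated {T : topologicalType} (G : set_system T) {FG : ProperFilter G}
    (u : nat -> T -> R) l b :
  (forall m, u m t @[t --> G] --> l m) ->
  (\forall t \near G, forall m, `|u m t| <= b m) -> cvgn (series b) ->
  cvgn (series l) /\
  limn (series (u^~ t)) @[t --> G] --> limn (series l).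
Proof.
move=> ul ub cb.
have lb m : `|l m| <= b m.
  have c1 : `|u m t| @[t --> G] --> `|l m| by exact: cvg_norm.
  have c2 : b m @[t --> G] --> b m by exact: cvg_cst.
  apply: (ler_cvg_to c1 c2).
  by apply: filterS ub => t /(_ m).
have [cl tl] := series_dominated lb cb.
split=> //; apply/cvgrPdist_lt => e e0.
have e3 : 0 < e / 3 by rewrite divr_gt0.
have /cvgrPdist_lt/(_ _ e3)[N _ /(_ N (leqnn N)) HN] := cb.
have tN : limn (series b) - series b N < e / 3.
  exact: le_lt_trans (ler_norm _) HN.
have cN : series (u^~ t) N @[t --> G] --> series l N.
  elim: N {HN tN} => [|N ih].
    rewrite (_ : series l 0%N = 0); last by rewrite /series /= big_geq.
    by under eq_cvg do rewrite /series /= big_geq//; exact: cvg_cst.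
  by rewrite seriesSr; under eq_cvg do rewrite seriesSr; exact: cvgD.
move/cvgrPdist_lt/(_ _ e3) : cN => cN.
near=> t.
have hub : forall m, `|u m t| <= b m by near: t.
have [cu tu] := series_dominated hub cb.
have h1 := tu N; have h2 := tl N.
have h3 : `|series l N - series (u^~ t) N| < e / 3 by near: t.
rewrite -(subrKA (series l N)) (le_lt_trans (ler_normD _ _))//.
rewrite -(subrKA (series (u^~ t) N) (series l N)).
have h4 := ler_normD (series l N - series (u^~ t) N)
  (series (u^~ t) N - limn (series (u^~ t))).
rewrite (distrC (series (u^~ t) N)) in h4.
by lra.
Unshelve. all: by end_near. Qed.

Lemma is_derive_cvgP (g : R -> R) (x d : R) :
  is_derive x 1 g d <-> t^-1 * (g (t + x) - g x) @[t --> 0^'] --> d.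
Proof.
have E : (fun t : R => t^-1 * (g (t + x) - g x)) =
    (fun t => t^-1 *: ((g \o shift x) (t *: (1 : R)) - g x)).
  by apply/funext => t /=; rewrite [t *: _]mulr1.
rewrite E; split=> [[+ <-]|gd].
  by rewrite /derivable /derive => /cvg_ex[l gl]; rewrite (cvg_lim _ gl).
by apply: DeriveDef; [apply/cvg_ex; exists d|exact/cvg_lim].
Qed.

(** Tannery's theorem applied to the difference quotients at [x]; a Lipschitz bound centred at [x]
    is exactly a bound on these quotients. *)
Lemma is_derive_series (h : nat -> R -> R) (x : R) d b :
  (forall m, is_derive x 1 (h m) (d m)) ->
  (\forall y \near x, cvgn (series (h^~ y))) ->
  (\forall y \near x, forall m, `|h m y - h m x| <= b m * `|y - x|) ->
  cvgn (series b) ->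
  cvgn (series d) /\
  is_derive x (1 : R) (fun y => limn (series (h^~ y))) (limn (series d)).
Proof.
move=> dh ch bh cb.
pose q m (t : R) := t^-1 * (h m (t + x) - h m x).
have shift0 P : (\forall y \near x, P y) -> \forall t \near 0^', P (t + x).
  move=> /= nP; apply: (@nbhs_dnbhs _ (0 : R)).
  have c0 : t + x @[t --> (0 : R)] --> x.
    rewrite -[X in _ --> X]add0r.
    by apply: cvgD; [exact: cvg_id|exact: cvg_cst].
  exact: c0.
have cq m : q m t @[t --> 0^'] --> d m by exact/is_derive_cvgP.
have [cd lq] : cvgn (series d) /\ limn (series (q^~ t)) @[t --> 0^'] --> limn (series d).
  apply: (cvg_series_dominated cq _ cb).
  near=> t => m.
  have t0 : t != 0 by near: t; exact: nbhs_dnbhs_neq.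
  have : `|h m (t + x) - h m x| <= b m * `|t + x - x| 
    by move: m; near: t; exact: (shift0 _ bh).
  by rewrite addrK /q normrM normfV ler_pdivrMl ?normr_gt0// mulrC.
split; first exact: cd.
apply/is_derive_cvgP; apply: cvg_trans lq; apply: near_eq_cvg; near=> t.
have c1 : cvgn (series (h^~ (t + x))) by near: t; exact: (shift0 _ ch).
have c2 : cvgn (series (h^~ x)) by exact: nbhs_singleton ch.
rewrite -lim_seriesB// -[RHS]lim_seriesZ//.
exact: is_cvg_seriesB.
Unshelve. all: by end_near. Qed.

End DominatedSeries.

(** * The fourth root and the series of m^(-5/4) *)

Section FourthRoot.
Context {R : realType}.
Implicit Types x y : R.

Definition root4 x : R := x `^ 4^-1.

Lemma root4_ge0 x : 0 <= root4 x. Proof. exact: powR_ge0. Qed.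

Lemma root4_gt0 x : 0 < x -> 0 < root4 x. Proof. by move=> x0; exact: powR_gt0. Qed.

Lemma ler_root4 x y : 0 <= x -> x <= y -> root4 x <= root4 y.
Proof.
move=> x0 xy; apply: ge0_ler_powR; rewrite ?nnegrE ?invr_ge0//.
exact: le_trans xy.
Qed.

Lemma root4M x y : 0 <= x -> 0 <= y -> root4 (x * y) = root4 x * root4 y.
Proof. exact: powRM. Qed.

Lemma root4X4 x : 0 <= x -> root4 x ^+ 4 = x.
Proof. by move=> x0; rewrite /root4 -powR_mulrn ?powR_ge0// -powRrM mulVf// powRr1. Qed.

Lemma root4_le1 x : 0 <= x <= 1 -> root4 x <= 1.
Proof.
move=> /andP[x0 x1].
by rewrite -[leRHS](_ : root4 1 = 1) ?ler_root4 // /root4 powR1.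
Qed.

(* With a = root4 m^-1 and b = root4 (m+1)^-1 one has a^4 - b^4 = a^4 b^4, so
   the terms b^5 are dominated by the telescoping differences 4 (a - b). *)
Lemma cvg_series_root4 : cvgn (series (fun m => root4 m%:R^-1 / m%:R : R)).
Proof.
pose v (m : nat) : R := 4 * root4 m%:R^-1.
have key m : root4 m.+2%:R^-1 / m.+2%:R <= v m.+1 - v m.+2 :> R.
  rewrite /v -mulrBr.
  have a0 : 0 < (m.+1%:R^-1 : R) by rewrite invr_gt0.
  have b0 : 0 < (m.+2%:R^-1 : R) by rewrite invr_gt0.
  have := root4X4 (ltW a0); have := root4X4 (ltW b0).
  have := root4_gt0 a0; have := root4_gt0 b0.
  have : root4 m.+2%:R^-1 <= root4 m.+1%:R^-1 :> R.
    by apply: ler_root4; [exact: ltW|rewrite lef_pV2 ?posrE// ler_nat].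
  set a := root4 m.+1%:R^-1; set b := root4 m.+2%:R^-1 => ba bp ap b4 a4.
  have ab : a ^+ 4 - b ^+ 4 = a ^+ 4 * b ^+ 4.
    rewrite a4 b4 -(natr1 m.+1); field.
    by have m0 : 0 <= m%:R :> R by []; apply/andP; split; apply: lt0r_neq0; lra.
  have -> : b / m.+2%:R = b * b ^+ 4 by rewrite b4.
  have : a ^+ 4 * b ^+ 4 <= (a - b) * (4 * a ^+ 3).
    rewrite -ab (_ : a ^+ 4 - b ^+ 4 =
      (a - b) * ((a + b) * (a ^+ 2 + b ^+ 2))); last by ring.
    apply: ler_wpM2l; first by rewrite subr_ge0.
    have -> : 4 * a ^+ 3 = (a + a) * (a ^+ 2 + a ^+ 2) by ring.
    apply: ler_pM; rewrite ?addr_ge0 ?sqr_ge0 ?(ltW ap) ?(ltW bp)//.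
      by rewrite lerD2l.
    by rewrite lerD2l lerXn2r// nnegrE ltW.
  move=> h; rewrite -(ler_pM2r (exprn_gt0 3 ap)).
  apply: (@le_trans _ _ (a ^+ 4 * b ^+ 4)); last first.
    by rewrite (_ : 4 * (a - b) * a ^+ 3 = (a - b) * (4 * a ^+ 3)); last by ring.
  rewrite (_ : a ^+ 4 * b ^+ 4 = a * b ^+ 4 * a ^+ 3); last by ring.
  by rewrite !ler_wpM2r ?exprn_ge0 ?(ltW ap) ?(ltW bp).
have nd : nondecreasing_seq (series (fun m => root4 m%:R^-1 / m%:R : R)).
  by apply: nondecreasing_series => m _ _ /=; rewrite divr_ge0 ?root4_ge0.
apply: nondecreasing_is_cvgn => //.
(* The m = 0 term is zero because 0^-1 = 0, the m = 1 term is 1, and the rest telescopes to at most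
   [v 1] = 4. *)
exists 5 => _ [n _ <-].
suff H k : series (fun m => root4 m%:R^-1 / m%:R : R) k.+2 <= 5 - v k.+1.
  apply: (@le_trans _ _ (series (fun m => root4 m%:R^-1 / m%:R : R) n.+2)).
    by apply: nd; rewrite -addn2 leq_addr.
  by rewrite (le_trans (H n))// gerBl mulr_ge0 ?root4_ge0.
elim: k => [|k ih].
  rewrite /series /= !big_nat_recr//= big_nil /v !invr0 mulr0 !invr1 /root4 powR1.
  by lra.
by rewrite seriesSr (le_trans (lerD ih (key k)))// subrKA.
Qed.

Lemma is_derive_root4 x : 0 < x -> is_derive x 1 root4 (4^-1 * (root4 x / x)).
Proof.
move=> x0; have := is_derive1_powR 4^-1 x0.
by rewrite powRB ?(gt_eqF x0) ?implybT// powRr1 ?ltW.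
Qed.

End FourthRoot.

(** * Measurability and integrals of bounded functions *)

Section BoundedIntegrals.
Context {R : realType}.
Local Notation leb := (@lebesgue_measure R).
Implicit Types (A : set R) (f : R -> R) (M L : R).

Lemma measurable_invr : measurable_fun [set: R] (@GRing.inv R).
Proof.
have m0 : measurable [set 0 : R] by exact: measurable_set1.
have -> : [set: R] = [set 0] `|` ~` [set 0] by rewrite setUv.
apply/measurable_funU => //; first exact: measurableC.
split; first exact: measurable_fun_set1.
apply: open_continuous_measurable_fun.
  apply: closed_openC; apply: accessible_closed_set1.
  exact/hausdorff_accessible/Rhausdorff.
by move=> x; rewrite inE /= => /eqP x0; exact: inv_continuous.
Qed.

Lemma measurable_floorr : measurable_fun [set: R] (fun x : R => (Num.floor x)%:~R : R).
Proof. by apply: nondecreasing_measurable => // x y xy; rewrite ler_int le_floor. Qed.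

Lemma measurable_fun_natr (b : R -> bool) A :
  measurable_fun A b -> measurable_fun A (fun x => (b x)%:R : R).
Proof.
move=> mb; rewrite (_ : (fun x => _) = (fun x => if b x then 1 else 0)).
  by move=> mA; apply: measurable_fun_if.
by apply/funext => x; case: (b x).
Qed.

Lemma integrable_bounded A f M : measurable A -> (leb A < +oo)%E ->
  measurable_fun A f -> (forall x, A x -> `|f x| <= M) ->
  leb.-integrable A (EFin \o f).
Proof.
move=> mA Aoo mf fM; apply: measurable_bounded_integrable => //.
exists M; split; first exact: num_real.
by move=> M' MM' x Ax; exact: le_trans (fM x Ax) (ltW MM').
Qed.

Lemma normr_Rintegral_le A f M L : measurable A -> (leb A <= L%:E)%E ->
  measurable_fun A f -> 0 <= M -> (forall x, A x -> `|f x| <= M) ->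
  `|\int[leb]_(x in A) f x| <= M * L.
Proof.
move=> mA AL mf M0 fM.
have Aoo : (leb A < +oo)%E by rewrite (le_lt_trans AL)// ltry.
have fi := integrable_bounded mA Aoo mf fM.
apply: (le_trans (le_normr_Rintegral _ fi)) => //.
apply: (@le_trans _ _ (\int[leb]_(x in A) M)).
  apply: le_Rintegral => //; first exact: integrable_norm.
  by apply: (@integrable_bounded _ _ `|M|).
rewrite Rintegral_cst//; apply: ler_wpM2l => //.
rewrite -[leRHS]/(fine L%:E) fine_le// ge0_fin_numE//.
Qed.

Lemma lebesgue_itvoc (a b : R) : a <= b -> leb `]a, b] = (b - a)%:E.
Proof.
move=> ab; rewrite lebesgue_measure_itv/= lte_fin.
move: ab; rewrite le_eqVlt => /predU1P[->|->]; last by rewrite EFinB.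
by rewrite ltxx subrr.
Qed.

Lemma Rintegral_midpoint (a b : R) : a < b ->
  \int[leb]_(y in `]a, b]) (y - (a + b) / 2) = 0.
Proof.
move=> ab; pose c := (a + b) / 2; pose G (y : R) := 2^-1 * (y - c) ^+ 2.
have dG (y : R) : is_derive y (1:R) G (y - c).
  rewrite /G; apply: is_derive_eq.
  by rewrite /GRing.scale /=; field.
have cf : continuous (fun y : R => y - c).
  by move=> y; apply: cvgB; [exact: cvg_id|exact: cvg_cst].
have cG : continuous G.
  by move=> y; apply: differentiable_continuous; apply/derivable1_diffP; apply: ex_derive.
rewrite Rintegral_itv_obnd_cbnd; last first.
  apply: (@integrable_bounded _ _ (b - a)) => //.
  - by rewrite lebesgue_itvoc ?ltW// ltry.
  - by apply: measurable_funB => //; exact: measurable_cst.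
  - move=> y; rewrite /= in_itv/= => /andP[ay yb]; rewrite ler_norml.
    by apply/andP; split; lra.
rewrite /Rintegral (@continuous_FTC2 _ _ G)//.
- by rewrite -EFinB /= /G /c; field.
- exact: continuous_subspaceT.
- split.
  + by move=> y _; apply: ex_derive.
  + exact/cvg_at_right_filter/cG.
  + exact/cvg_at_left_filter/cG.
- by move=> y _; rewrite derive1E derive_val.
Qed.

End BoundedIntegrals.

(** * Pointwise estimates for the kernel and its truncation *)

Section Kernel.
Context {R : realType}.
Local Notation leb := (@lebesgue_measure R).
Implicit Types (x y t : R) (m n N : nat).

Lemma fracpart_itv t : 0 <= fracpart t < 1.
Proof.
by rewrite /fracpart subr_ge0 floor_le/= ltrBlDl; have /andP[_] := floor_itv t;
  rewrite intrD addrC.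
Qed.

Lemma Kker_half x y : `|Kker x y| <= 2^-1.
Proof.
rewrite /Kker; case: ifPn => _; last by rewrite normr0 invr_ge0.
have /andP[] := fracpart_itv (x * y)^-1; rewrite ler_norml => ? ?.
by apply/andP; split; lra.
Qed.

Lemma measurable_Kker x A : measurable_fun A (Kker x).
Proof.
apply: (@measurable_funS _ _ _ _ setT) => //.
have mx : measurable_fun [set: R] (fun y => x * y) by exact: measurable_funM.
apply: measurable_fun_ifT => //.
  rewrite (_ : (fun y => _) = (fun y => ~~ (x * y == 0)))//.
  by apply: measurable_neg; apply: measurable_fun_eqr => //; exact: measurable_cst.
have mi : measurable_fun [set: R] (fun y => (x * y)^-1).
  exact: (measurableT_comp measurable_invr mx).
apply: measurable_funB => //.
by apply: measurable_funB => //; exact: (measurableT_comp measurable_floorr mi).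
Qed.

(** Counting the positive integers below t writes an integer part as a sum of indicators, each of
    which integrates against f to a value of F. *)
Lemma sum_le_truncn N t :
  \sum_(1 <= m < N.+1) (m%:R <= t)%R%:R = (minn (Num.truncn t) N)%:R :> R.
Proof.
elim: N => [|N ih]; first by rewrite big_geq// minn0.
rewrite big_nat_recr//= ih -truncn_gt_nat -natrD; congr (_%:R).
case: (ltnP N) => h; rewrite /= ?addn0 ?addn1.
  by rewrite !(minn_idPr _)// ltnW.
by rewrite !(minn_idPl _)// ltnW.
Qed.

(* Truncating both [(x y)^-1] and its integer part at [N] leaves the kernel
   unchanged for [y > (N x)^-1]. *)
Definition truncK N x y : R := 2^-1 - Num.min (x * y)^-1 N%:R +
  \sum_(1 <= m < N.+1) (y <= (m%:R * x)^-1)%R%:R.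

Lemma Kker_truncK N x y : 0 < x -> 0 < y -> (0 < N)%N ->
  `|Kker x y - truncK N x y| <= (y <= (N%:R * x)^-1)%R%:R.
Proof.
move=> x0 y0 N0; have xy0 : 0 < x * y by rewrite mulr_gt0.
have E m : (0 < m)%N -> (y <= (m%:R * x)^-1) = (m%:R <= (x * y)^-1).
  move=> m0; have m0' : 0 < m%:R :> R by rewrite ltr0n.
  rewrite -[(m%:R * x)^-1]mul1r ler_pdivlMr ?mulr_gt0//.
  rewrite -[(x * y)^-1]mul1r ler_pdivlMr//.
  by congr (_ <= _); ring.
rewrite /Kker gt_eqF//= /truncK E//.
under eq_big_nat => m /andP[m0 _] do rewrite E//.
rewrite sum_le_truncn /fracpart; set t := (x * y)^-1.
have t0 : 0 <= t by rewrite invr_ge0 ltW.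
have fE : (Num.floor t)%:~R = (Num.truncn t)%:R :> R.
  by rewrite truncn_floor t0 pmulrn gez0_abs ?floor_ge0.
have /andP[f1 f2] := fracpart_itv t; rewrite /fracpart fE in f1 f2.
(* For t >= N the truncated kernel is 1/2 - N + N = 1/2, so the difference is a fractional part up
   to sign; for t < N the two kernels agree. *)
rewrite fE; have [Nt|tN] := leP N%:R t.
  have -> : minn (Num.truncn t) N = N by apply/minn_idPr; rewrite truncn_ge_nat.
  by rewrite ler_norml mulr1n; apply/andP; split; lra.
have -> : minn (Num.truncn t) N = Num.truncn t.
  by apply/minn_idPl; rewrite -ltnS truncn_lt_nat// (lt_le_trans tN)// ler_nat.
by rewrite (_ : _ - _ = 0) ?normr0//; lra.
Qed.

Lemma measurable_truncK N x A : measurable_fun A (truncK N x).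
Proof.
apply: (@measurable_funS _ _ _ _ setT) => //.
have mx : measurable_fun [set: R] (fun y => x * y) by exact: measurable_funM.
have mi : measurable_fun [set: R] (fun y => (x * y)^-1).
  exact: (measurableT_comp measurable_invr mx).
apply: measurable_funD.
  by apply: measurable_funB => //; exact: measurable_minr.
apply: measurable_sum => m.
by apply: measurable_fun_natr; exact: measurable_fun_ler.
Qed.

End Kernel.

(** * Kernel integrals of a bounded function, and the decay of eigenfunctions *)

Section KernelIntegral.
Context {R : realType} (f : R -> R) (M : R).
Context (mf : measurable_fun [set: R] f) (fM : forall y : R, `|f y| <= M)
  (f0 : forall y : R, ~~ (0 < y <= 1) -> f y = 0).
Local Notation leb := (@lebesgue_measure R).
Local Notation J := (`]0, 1]%classic : set R).
Implicit Types (s t u v x y B om : R) (m n p q N : nat).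

Let M0 : 0 <= M. Proof. exact: le_trans (fM 0). Qed.

Let mfA A : measurable_fun A f. Proof. exact: measurable_funS mf. Qed.

Let leb_itv_lty s t : (leb `]s, t] < +oo)%E.
Proof.
by rewrite lebesgue_measure_itv/=; case: ifPn => _; rewrite -?EFinB ltry.
Qed.

Lemma integrable_itvoc_bounded (g : R -> R) B s t :
  measurable_fun `]s, t] g -> (forall y, s < y <= t -> `|g y| <= B) ->
  leb.-integrable `]s, t] (EFin \o g).
Proof.
by move=> mg gB; apply: (@integrable_bounded _ _ _ B).
Qed.

Lemma normr_Rintegral_itvoc_le (g : R -> R) B s t : s <= t ->
  measurable_fun `]s, t] g -> 0 <= B -> (forall y, s < y <= t -> `|g y| <= B) ->
  `|\int[leb]_(y in `]s, t]) g y| <= B * (t - s).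
Proof.
move=> st mg B0 gB; apply: normr_Rintegral_le => //.
by rewrite lebesgue_itvoc.
Qed.

(** Stated for every t >= 0, because the threshold 1/(N x) to which it is applied may exceed 1. *)
Lemma normr_Rintegral_indic_le (g : R -> R) B t : 0 <= t ->
  measurable_fun J g -> 0 <= B ->
  (forall y, 0 < y <= 1 -> `|g y| <= B * (y <= t)%R%:R) ->
  `|\int[leb]_(y in J) g y| <= B * t.
Proof.
move=> t0 mg B0 gB.
have -> : \int[leb]_(y in J) g y = \int[leb]_(y in J `&` `]-oo, t]) g y.
  rewrite Rintegral_mkcondr; apply: eq_Rintegral => y.
  rewrite inE /= in_itv/= => yJ; rewrite patchE.
  case: ifPn => // yt; apply/eqP; rewrite -normr_le0 (le_trans (gB _ yJ))//.
  move: yt; rewrite notin_setE /= in_itv/= => /negP/negbTE ->.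
  by rewrite mulr0.
apply: normr_Rintegral_le => //; first exact: measurableI.
- have -> : t%:E = leb `]0, t] by rewrite lebesgue_itvoc// subr0.
  apply: le_measure; rewrite ?inE//=.
    exact: measurableI.
  by move=> y /=; rewrite !in_itv/= => -[/andP[-> _] ->].
- by apply: measurable_funS mg => // y [].
- move=> y /= [] /[!in_itv]/= yJ yt.
  by rewrite (le_trans (gB _ yJ))// yt mulr1.
Qed.

(** The function F of the overview. *)
Definition prim t : R := \int[leb]_(y in `]0, t]) f y.

Lemma integrable_f s t : leb.-integrable `]s, t] (EFin \o f).
Proof. exact: integrable_itvoc_bounded. Qed.

Lemma prim0 : prim 0 = 0.
Proof. by rewrite /prim set_itv_ge ?Rintegral_set0// bnd_simp ltxx. Qed.

Lemma primB s t : 0 <= s -> s <= t -> prim t - prim s = \int[leb]_(y in `]s, t]) f y.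
Proof.
move=> s0 st; rewrite /prim Rintegral_itvB//; exact: integrable_f.
Qed.

Lemma prim_lipschitz B s t : 0 <= s -> s <= t -> 0 <= B ->
  (forall y, s < y <= t -> `|f y| <= B) -> `|prim t - prim s| <= B * (t - s).
Proof. by move=> s0 st B0 fB; rewrite primB//; exact: normr_Rintegral_itvoc_le. Qed.

Lemma prim_indic t : \int[leb]_(y in J) ((y <= t)%R%:R * f y) = prim t.
Proof.
rewrite /prim [LHS]Rintegral_mkcond [RHS]Rintegral_mkcond.
suff E (y : R) : ((fun y => (y <= t)%R%:R * f y) \_ J) y = (f \_ `]0, t]) y.
  by apply: eq_Rintegral => y _; exact: E.
rewrite !patchE !mem_setE !in_itv/= (_ : point = 0 :> R)//.
have [y01|/f0 ->] := boolP (0 < y <= 1); last by rewrite if_same.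
rewrite (andP y01).1.
by case: (y <= t); rewrite ?mul1r ?mul0r.
Qed.

Let measurable_minKer N x A :
  measurable_fun A (fun y => Num.min (x * y)^-1 N%:R * f y).
Proof.
apply: (@measurable_funS _ _ _ _ setT) => //.
apply: measurable_funM => //; apply: measurable_minr => //.
by apply: (measurableT_comp measurable_invr); exact: measurable_funM.
Qed.

Let measurable_indicf t A : measurable_fun A (fun y => (y <= t)%R%:R * f y).
Proof.
apply: (@measurable_funS _ _ _ _ setT) => //.
by apply: measurable_funM => //; apply: measurable_fun_natr; exact: measurable_fun_ler.
Qed.

Let normr_indicf t y : `|(y <= t)%R%:R * f y| <= M.
Proof.
by case: (y <= t); rewrite ?mul1r ?mul0r ?normr0.
Qed.

Let min_itv N x y : 0 < x -> 0 < y -> 0 <= Num.min (x * y)^-1 N%:R <= N%:R.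
Proof.
by move=> x0 y0; rewrite le_min ge_min lexx orbT ler0n invr_ge0 mulr_ge0 ?ltW.
Qed.

Lemma Rintegral_truncK N x : 0 < x ->
  \int[leb]_(y in J) (truncK N x y * f y) =
  2^-1 * prim 1 - \int[leb]_(y in J) (Num.min (x * y)^-1 N%:R * f y) +
  \sum_(1 <= m < N.+1) prim (m%:R * x)^-1.
Proof.
move=> x0; pose h n y := \sum_(1 <= m < n.+1) ((y <= (m%:R * x)^-1)%R%:R * f y).
have mh n A : measurable_fun A (h n).
  by apply: measurable_sum => m; exact: measurable_indicf.
have hM n y : `|h n y| <= n%:R * M.
  rewrite (le_trans (ler_norm_sum _ _ _))//.
  rewrite (le_trans (ler_sum _ (fun m _ => normr_indicf _ y)))//.
  by rewrite sumr_const_nat subSS subn0 mulr_natl.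
have hE n : \int[leb]_(y in J) h n y = \sum_(1 <= m < n.+1) prim (m%:R * x)^-1.
  elim: n => [|n ih].
    rewrite big_geq// /h; under eq_Rintegral do rewrite big_geq//.
    by rewrite Rintegral_cst// mul0r.
  rewrite big_nat_recr//= -ih -prim_indic -RintegralD//.
  - by apply: eq_Rintegral => y _; rewrite /h big_nat_recr.
  - by apply: integrable_itvoc_bounded => // y _; exact: hM.
  - by apply: integrable_itvoc_bounded => // y _; exact: normr_indicf.
have i2 : leb.-integrable J (EFin \o (fun y => 2^-1 * f y)).
  apply: (@integrable_itvoc_bounded _ (2^-1 * M)).
    by apply: (@measurable_funS _ _ _ _ setT) => //; exact: measurable_funM.
  by move=> y _; rewrite normrM ger0_norm ?invr_ge0// ler_wpM2l ?invr_ge0.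
have im : leb.-integrable J (EFin \o (fun y => Num.min (x * y)^-1 N%:R * f y)).
  apply: (@integrable_itvoc_bounded _ (N%:R * M)) => // y /andP[y0 _].
  have /andP[m0 mN] := min_itv N x0 y0.
  by rewrite normrM ger0_norm// ler_pM.
rewrite -hE /prim -RintegralZl ?integrable_f// -RintegralB// -RintegralD//.
- apply: eq_Rintegral => y _.
  by rewrite /truncK mulrDl mulrBl /h mulr_suml.
- apply: (@integrable_itvoc_bounded _ (2^-1 * M + N%:R * M)).
    apply: (@measurable_funS _ _ _ _ setT) => //; apply: measurable_funB => //.
    exact: measurable_funM.
  move=> y /andP[y0 _]; rewrite (le_trans (ler_normB _ _))// lerD//.
    by rewrite normrM ger0_norm ?invr_ge0// ler_wpM2l ?invr_ge0.
  have /andP[m0 mN] := min_itv N x0 y0.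
  by rewrite normrM ger0_norm// ler_pM.
- by apply: integrable_itvoc_bounded => // y _; exact: hM.
Qed.

Let measurable_Kf x A : measurable_fun A (fun y => Kker x y * f y).
Proof. by apply: measurable_funM => //; exact: measurable_Kker. Qed.

Let normr_Kf x y : `|Kker x y * f y| <= M.
Proof.
rewrite normrM (le_trans (ler_pM _ _ (Kker_half x y) (fM y)))//.
by have := M0; lra.
Qed.

Lemma Rintegral_Kker_truncK N x : 0 < x -> (0 < N)%N ->
  `|\int[leb]_(y in J) (Kker x y * f y) - \int[leb]_(y in J) (truncK N x y * f y)|
  <= M * (N%:R * x)^-1.
Proof.
move=> x0 N0; rewrite -RintegralB//.
- apply: normr_Rintegral_indic_le => //.
  + by rewrite invr_ge0 mulr_ge0// ltW.
  + apply: measurable_funB => //; apply: measurable_funM => //.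
    exact: measurable_truncK.
  move=> y /andP[y0 _]; rewrite -mulrBl normrM mulrC ler_pM//.
  exact: Kker_truncK.
- by apply: integrable_itvoc_bounded => // y _; exact: normr_Kf.
- apply: (@integrable_itvoc_bounded _ ((2^-1 + N%:R + N%:R) * M)).
    by apply: measurable_funM => //; exact: measurable_truncK.
  move=> y /andP[y0 _]; rewrite normrM ler_pM//.
  have /andP[m0 mN] := min_itv N x0 y0.
  rewrite /truncK (le_trans (ler_normD _ _))// lerD//.
    by rewrite ler_norml; apply/andP; split; lra.
  rewrite (le_trans (ler_norm_sum _ _ _))//.
  have : \sum_(1 <= m < N.+1) `|(y <= (m%:R * x)^-1)%R%:R : R| <= \sum_(1 <= m < N.+1) 1.
    by apply: ler_sum => m _; case: (y <= _); rewrite ?normr1 ?normr0.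
  by rewrite sumr_const_nat subSS subn0.
Qed.

(** Passing to the truncated kernel costs at most M/(N u) at each of the two points. The truncated
    integrals differ through the minimum and through the sum of values of F, each by at most N M
    (1/u - 1/v). The parameter N stays free, to be balanced later. *)
Lemma Rintegral_Kker_modulus N u v : 0 < u -> u <= v -> v <= 1 -> (0 < N)%N ->
  `|\int[leb]_(y in J) (Kker u y * f y) - \int[leb]_(y in J) (Kker v y * f y)|
  <= M * (2 * (N%:R * u)^-1 + 2 * N%:R * (u^-1 - v^-1)).
Proof.
move=> u0 uv v1 N0; have v0 := lt_le_trans u0 uv.
have N0' : 0 < N%:R :> R by rewrite ltr0n.
have Ku := Rintegral_Kker_truncK u0 N0.
have Kv := Rintegral_Kker_truncK v0 N0.
have uvV : v^-1 <= u^-1 by rewrite lef_pV2.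
have NuvV : (N%:R * v)^-1 <= (N%:R * u)^-1.
  by rewrite lef_pV2 ?posrE ?mulr_gt0// ler_pM2l.
rewrite !Rintegral_truncK// in Ku Kv.
have im x : 0 < x -> leb.-integrable J (EFin \o (fun y => Num.min (x * y)^-1 N%:R * f y)).
  move=> x0; apply: (@integrable_itvoc_bounded _ (N%:R * M)) => // y /andP[y0 _].
  have /andP[m0 mN] := min_itv N x0 y0.
  by rewrite normrM ger0_norm// ler_pM.
have mind : `|\int[leb]_(y in J) (Num.min (u * y)^-1 N%:R * f y) -
    \int[leb]_(y in J) (Num.min (v * y)^-1 N%:R * f y)| <= N%:R * (u^-1 - v^-1) * M.
  rewrite -RintegralB//; [|exact: im..].
  rewrite [leRHS](_ : _ = (N%:R * (u^-1 - v^-1) * M) * (1 - 0)); last first.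
    by rewrite subr0 mulr1.
  apply: normr_Rintegral_itvoc_le => //.
  - exact: measurable_funB.
  - by rewrite !mulr_ge0// subr_ge0.
  move=> y /andP[y0 y1]; rewrite -mulrBl normrM ler_pM//.
  have vuy : (v * y)^-1 <= (u * y)^-1 by rewrite lef_pV2 ?posrE ?mulr_gt0// ler_pM2r.
  (* Either both minima equal N, or 1/y <= 1/(v y) < N because v <= 1, and then the difference is at
     most (1/u - 1/v)/y. *)
  have [Nv|vN] := leP N%:R (v * y)^-1.
    have Nu := le_trans Nv vuy; rewrite (min_r Nu) subrr normr0.
    by rewrite mulr_ge0// subr_ge0.
  have yN : y^-1 <= N%:R.
    rewrite (le_trans _ (ltW vN))// lef_pV2 ?posrE ?mulr_gt0//.
    by rewrite ler_piMl// ltW.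
  have mu : Num.min (u * y)^-1 N%:R <= (u * y)^-1 by rewrite ge_min lexx.
  have mv : (v * y)^-1 <= Num.min (u * y)^-1 N%:R by rewrite le_min vuy ltW.
  rewrite ger0_norm ?subr_ge0//.
  apply: (@le_trans _ _ (y^-1 * (u^-1 - v^-1))).
    rewrite mulrBr -!invfM (mulrC y u) (mulrC y v).
    by rewrite lerD2r.
  by rewrite ler_wpM2r// subr_ge0.
have sumd : `|\sum_(1 <= m < N.+1) prim (m%:R * u)^-1 -
    \sum_(1 <= m < N.+1) prim (m%:R * v)^-1| <= N%:R * (u^-1 - v^-1) * M.
  rewrite -sumrB (le_trans (ler_norm_sum _ _ _))//.
  have -> : N%:R * (u^-1 - v^-1) * M = \sum_(1 <= m < N.+1) ((u^-1 - v^-1) * M).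
    by rewrite sumr_const_nat subSS subn0 -mulrA mulr_natl.
  rewrite big_nat [leRHS]big_nat; apply: ler_sum => m /andP[m0 _].
  have m0' : 0 < m%:R :> R by rewrite ltr0n.
  apply: (le_trans (@prim_lipschitz M _ _ _ _ _ _)) => //.
  - by rewrite invr_ge0 mulr_ge0 ?ltW.
  - by rewrite lef_pV2 ?posrE ?mulr_gt0// ler_pM2l.
  rewrite mulrC ler_wpM2r// !invfM -mulrBr ler_piMl ?subr_ge0//.
  by rewrite invf_le1// ler1n.
have h3 : M * (N%:R * v)^-1 <= M * (N%:R * u)^-1 by rewrite ler_wpM2l.
rewrite !ler_norml in Ku Kv mind sumd *.
move: Ku Kv mind sumd => /andP[? ?] /andP[? ?] /andP[? ?] /andP[? ?].
by apply/andP; split; lra.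
Qed.

(* On a branch of the fractional part the kernel is within [x] of the affine
   function [y |-> (y - c) / (b - a)], whose mean over the branch vanishes. *)
Lemma Rintegral_Kker_branch x n om : 0 < x -> (0 < n)%N ->
  let a := (n.+1%:R * x)^-1 in let b := (n%:R * x)^-1 in b <= 1 ->
  0 <= om -> (forall y, a < y <= b -> `|f y - f a| <= om) ->
  `|\int[leb]_(y in `]a, b]) (Kker x y * f y)| <= (x * M + om) * (b - a).
Proof.
move=> x0 n0 a b b1 om0 fom.
have n0' : 0 < n%:R :> R by rewrite ltr0n.
have n1' : 0 < n.+1%:R :> R by rewrite ltr0n.
have a0 : 0 < a by rewrite invr_gt0 mulr_gt0.
have b0 : 0 < b by rewrite invr_gt0 mulr_gt0.
have aE : a^-1 = (n%:R + 1) * x by rewrite invrK natr1.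
have bE : b^-1 = n%:R * x by rewrite invrK.
have baE : b - a = x * a * b.
  by rewrite /a /b -natr1; field; rewrite natr1 !gt_eqF.
have ab : a < b by rewrite -subr_gt0 baE !mulr_gt0.
(* The subtracted function is [f a] times the affine approximation of the kernel; having mean zero,
   it leaves the integral unchanged. *)
pose c := (a + b) / 2; pose d := f a / (b - a).
have mL : measurable_fun `]a, b] (fun y => d * (y - c)).
  apply: (@measurable_funS _ _ _ _ setT) => //; apply: measurable_funM => //.
  by apply: measurable_funB.
have Lab y : a < y <= b -> `|y - c| <= b - a.
  by move=> /andP[ay yb]; rewrite /c ler_norml; apply/andP; split; lra.
have iL : leb.-integrable `]a, b] (EFin \o (fun y => y - c)).
  apply: (@integrable_itvoc_bounded _ (b - a)) => //.
  exact: measurable_funB.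
have idL : leb.-integrable `]a, b] (EFin \o (fun y => d * (y - c))).
  apply: (@integrable_itvoc_bounded _ (`|d| * (b - a))) => //.
  by move=> y yab; rewrite normrM ler_wpM2l// Lab.
have iK : leb.-integrable `]a, b] (EFin \o (fun y => Kker x y * f y)).
  by apply: integrable_itvoc_bounded => // y _; exact: normr_Kf.
have -> : \int[leb]_(y in `]a, b]) (Kker x y * f y) =
    \int[leb]_(y in `]a, b]) (Kker x y * f y - d * (y - c)).
  by rewrite RintegralB// RintegralZl// Rintegral_midpoint// mulr0 subr0.
apply: normr_Rintegral_itvoc_le.
- exact: ltW.
- exact: measurable_funB.
- by rewrite addr_ge0// mulr_ge0// ltW.
move=> y yab; have /andP[ay yb] := yab; have y0 := lt_trans a0 ay.
have KE : Kker x y = 2^-1 + n%:R - (x * y)^-1.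
  rewrite /Kker gt_eqF ?mulr_gt0//= /fracpart (@floor_def _ _ n%:Z).
    by rewrite -pmulrn; ring.
  rewrite intrD -!pmulrn; apply/andP; split.
    rewrite -[(x * y)^-1]mul1r ler_pdivlMr ?mulr_gt0// mulrA -ler_pdivlMl ?mulr_gt0//.
    by rewrite mulr1.
  rewrite -[(x * y)^-1]mul1r ltr_pdivrMr ?mulr_gt0// mulrA -ltr_pdivrMl ?mulr_gt0//.
  by rewrite mulr1 natr1.
(* The affine function is the chord of the kernel on the branch, running from -1/2 to 1/2, so the
   error has the factors y - a and b - y. Bounding both by b - a = x a b leaves x a b / y, which is
   at most x since a < y and b <= 1. *)
have KL : `|Kker x y - (y - c) / (b - a)| <= x.
  have -> : Kker x y - (y - c) / (b - a) = (y - a) * (b - y) / (x * a * b * y).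
    rewrite KE baE /c.
    have -> : n%:R = b^-1 / x by rewrite bE mulfK// gt_eqF.
    have xE : x = (b - a) / (a * b) by rewrite baE -mulrA mulfK// gt_eqF// mulr_gt0.
    rewrite xE; field; rewrite !gt_eqF//= subr_gt0//.
  rewrite ger0_norm; last first.
    apply: divr_ge0; first by rewrite mulr_ge0// subr_ge0// ltW.
    by rewrite !mulr_ge0// ltW.
  rewrite ler_pdivrMr ?mulr_gt0//.
  apply: (@le_trans _ _ ((b - a) * (b - a))).
    by apply: ler_pM; rewrite ?subr_ge0 ?(ltW ay)// ?lerB// ltW.
  rewrite baE.
  rewrite (_ : x * a * b * (x * a * b) = (x * (x * a * b)) * (a * b)); last by ring.
  rewrite (_ : x * (x * a * b * y) = x * (x * a * b) * y); last by ring.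
  apply: ler_wpM2l; first by rewrite !mulr_ge0// ltW.
  by rewrite (le_trans _ (ltW ay))// ler_piMr// ltW.
have -> : Kker x y * f y - d * (y - c) =
    (Kker x y - (y - c) / (b - a)) * f a + Kker x y * (f y - f a).
  by rewrite /d; field; rewrite gt_eqF// subr_gt0.
rewrite (le_trans (ler_normD _ _))// lerD// normrM.
  by rewrite ler_pM.
rewrite -[leRHS]mul1r ler_pM// ?fom// (le_trans (Kker_half x y))//.
by rewrite invf_le1// ler1n.
Qed.

Lemma Rintegral_Kker_branches x q p om : 0 < x -> (0 < q <= p)%N ->
  (q%:R * x)^-1 <= 1 -> 0 <= om ->
  (forall n y, (q <= n < p)%N -> (n.+1%:R * x)^-1 < y <= (n%:R * x)^-1 ->
    `|f y - f (n.+1%:R * x)^-1| <= om) ->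
  `|\int[leb]_(y in `](p%:R * x)^-1, (q%:R * x)^-1]) (Kker x y * f y)| <=
  (x * M + om) * ((q%:R * x)^-1 - (p%:R * x)^-1).
Proof.
move=> x0 /andP[q0 qp] q1 om0.
have inv_ge m n : (0 < m <= n)%N -> (n%:R * x)^-1 <= (m%:R * x)^-1.
  move=> /andP[m0 mn]; have n0 := leq_trans m0 mn.
  by rewrite lef_pV2 ?posrE ?mulr_gt0 ?ltr0n// ler_pM2r// ler_nat.
elim: p qp => [|p ih]; first by rewrite leqNgt q0.
rewrite leq_eqVlt => /predU1P[->|qp] fom.
  by rewrite set_itv_ge ?bnd_simp ?ltxx// Rintegral_set0 normr0 subrr mulr0.
rewrite ltnS in qp; have p0 := leq_trans q0 qp.
have hp1 : (p.+1%:R * x)^-1 <= (p%:R * x)^-1 by rewrite inv_ge// p0 leqnSn.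
have hpq : (p%:R * x)^-1 <= (q%:R * x)^-1 by rewrite inv_ge// q0.
have iK s t : leb.-integrable `]s, t] (EFin \o (fun y => Kker x y * f y)).
  by apply: integrable_itvoc_bounded => // y _; exact: normr_Kf.
have := @Rintegral_itvB _ _ (BRight (p.+1%:R * x)^-1) (BRight (q%:R * x)^-1)
  (p%:R * x)^-1 (iK _ _).
rewrite !bnd_simp => /(_ hp1 hpq)/(canRL (subrK _)) ->.
rewrite (le_trans (ler_normD _ _))//.
rewrite (_ : (q%:R * x)^-1 - (p.+1%:R * x)^-1 =
  ((q%:R * x)^-1 - (p%:R * x)^-1) + ((p%:R * x)^-1 - (p.+1%:R * x)^-1)); last by ring.
rewrite mulrDr lerD//.
  apply: ih => // n y /andP[qn np]; apply: fom.
  by rewrite qn ltnS ltnW.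
apply: Rintegral_Kker_branch => //; first exact: le_trans q1.
by move=> y; apply: fom; rewrite qp ltnSn.
Qed.

(** Cancellation is used only between the two cuts. Below 1/(p x) the branches are too many for the
    modulus to help, and above 1/(q x) a branch may be incomplete; both pieces are bounded by M
    times their length. *)
Lemma Rintegral_Kker_le x q p om : 0 < x -> (0 < q <= p)%N ->
  (q%:R * x)^-1 <= 1 -> 0 <= om ->
  (forall n y, (q <= n < p)%N -> (n.+1%:R * x)^-1 < y <= (n%:R * x)^-1 ->
    `|f y - f (n.+1%:R * x)^-1| <= om) ->
  `|\int[leb]_(y in J) (Kker x y * f y)| <=
  M * (p%:R * x)^-1 + (x * M + om) + M * (1 - (q%:R * x)^-1).
Proof.
move=> x0 qp q1 om0 fom; have /andP[q0 qp'] := qp.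
have p0 : 0 <= (p%:R * x)^-1 by rewrite invr_ge0 mulr_ge0// ltW.
have hpq : (p%:R * x)^-1 <= (q%:R * x)^-1.
  rewrite lef_pV2 ?posrE ?mulr_gt0 ?ltr0n// ?(leq_trans q0)//.
  by rewrite ler_pM2r// ler_nat.
have iK s t : leb.-integrable `]s, t] (EFin \o (fun y => Kker x y * f y)).
  by apply: integrable_itvoc_bounded => // y _; exact: normr_Kf.
have := @Rintegral_itvB _ _ (BRight 0) (BRight 1) (q%:R * x)^-1 (iK _ _).
rewrite !bnd_simp => /(_ (le_trans p0 hpq) q1)/(canRL (subrK _)) ->.
have := @Rintegral_itvB _ _ (BRight 0) (BRight (q%:R * x)^-1) (p%:R * x)^-1 (iK _ _).
rewrite !bnd_simp => /(_ p0 hpq)/(canRL (subrK _)) ->.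
rewrite addrC (le_trans (ler_normD _ _))// lerD//; last first.
  exact: normr_Rintegral_itvoc_le.
rewrite addrC (le_trans (ler_normD _ _))// lerD//.
  by rewrite -[X in M * X]subr0; exact: normr_Rintegral_itvoc_le.
rewrite (le_trans (Rintegral_Kker_branches x0 qp q1 om0 fom))//.
rewrite ler_piMr//; first by rewrite addr_ge0// mulr_ge0// ltW.
by lra.
Qed.

(* With [k] the integer part of [(root4 x)^-1]: truncating the kernel at [k ^ 3]
   makes [f] oscillate by [O(root4 x)] on each branch beyond [(16 k ^ 5 x)^-1]. *)
Lemma eigenfun_decay lam :
  (forall x : R, 0 < x <= 1 -> f x = lam * \int[leb]_(y in J) (Kker x y * f y)) ->
  forall x, `|f x| <= `|lam| * M * (4 + 66 * `|lam|) * root4 x.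
Proof.
move=> fE x; have [x01|/f0 ->] := boolP (0 < x <= 1); last first.
  by rewrite normr0 !mulr_ge0// ?root4_ge0// addr_ge0// mulr_ge0.
have /andP[x0 x1] := x01.
have w0 := root4_gt0 x0; have wx := root4X4 (ltW x0).
have w1 : root4 x <= 1 by rewrite root4_le1// ltW.
set w := root4 x in w0 wx w1 *.
(* The product k w lies in (1/2, 1], so k can replace x^(-1/4) up to a factor 2. *)
pose k := Num.truncn w^-1; have wV0 : 0 <= w^-1 by rewrite invr_ge0 ltW.
have k0 : (0 < k)%N by rewrite truncn_gt0 invf_ge1.
have k0' : 1 <= k%:R :> R by rewrite ler1n.
have kw : k%:R * w <= 1.
  by rewrite -ler_pdivlMr// mul1r -truncn_ge_nat.
have kw2 : 1 < 2 * (k%:R * w).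
  have : w^-1 < k.+1%:R by rewrite -truncn_le_nat.
  rewrite -[w^-1]mul1r ltr_pdivrMr// -natr1 => h.
  have : w <= k%:R * w by rewrite ler_peMl// ltW.
  by lra.
have kV : k%:R^-1 <= 2 * w.
  by rewrite -[_^-1]mul1r ler_pdivrMr ?ltr0n// -mulrA (mulrC w) ltW.
have xw : x <= w.
  by rewrite -wx -[leRHS]mulr1 exprSr mulrC ler_pM// ?exprn_ge0 ?exprn_ile1 ?(ltW w0).
(* Since 16 = 2^4 absorbs the loss in k w > 1/2, p x lies between k and 16 k, which puts the lower
   cut below 1/k <= 2 w. The choice of q gives 1 <= q x <= 1 + x, so the upper cut is within x of
   1. *)
pose p := (16 * k ^ 5)%N; pose q := (Num.truncn x^-1).+1.
have kw4 : 1 < 16 * (k%:R * w) ^+ 4.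
  rewrite (_ : 16 * _ = (2 * (k%:R * w)) ^+ 4); last by ring.
  by rewrite exprn_egt1.
have pxE : p%:R * x = 16 * (k%:R * w) ^+ 4 * k%:R.
  by rewrite /p natrM natrX -wx; ring.
have px1 : k%:R < p%:R * x by rewrite pxE ltr_pMl// ltr0n.
have px2 : p%:R * x <= 16 * k%:R.
  rewrite pxE ler_wpM2r//.
  by rewrite ler_piMr// exprn_ile1// mulr_ge0// ltW.
have xV0 : 0 <= x^-1 by rewrite invr_ge0 ltW.
have qx1 : 1 <= q%:R * x.
  by rewrite -ler_pdivrMr// mul1r ltW// -truncn_le_nat.
have qx2 : q%:R * x <= 1 + x.
  rewrite /q -natr1 mulrDl mul1r lerD2r -ler_pdivlMr// mul1r.
  by rewrite -truncn_ge_nat.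
have qp : (0 < q <= p)%N.
  rewrite /=/q -(ltr_nat R) (@le_lt_trans _ _ x^-1)//; first by rewrite -truncn_ge_nat.
  by rewrite -[x^-1]mul1r ltr_pdivrMr// (le_lt_trans k0').
have M0' := M0.
have om0 : 0 <= 66 * `|lam| * M * w by rewrite !mulr_ge0// ltW.
have qV : (q%:R * x)^-1 <= 1 by rewrite invf_le1// (lt_le_trans _ qx1).
have := Rintegral_Kker_le x0 qp qV om0.
rewrite fE// normrM => H.
(* The 4 collects 2 w from the piece near 0, w from the chord error x M, and w from the piece near
   1; the 66 comes from the oscillation. *)
rewrite (_ : `|lam| * M * (4 + 66 * `|lam|) * w =
  `|lam| * (M * (2 * w) + (w * M + 66 * `|lam| * M * w) + M * w)); last by ring.
rewrite ler_wpM2l//; apply: le_trans (H _) _.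
  move=> n y /andP[qn np] /andP[ay yb].
  set a := (n.+1%:R * x)^-1 in ay *.
  have n0 : (0 < n)%N by rewrite (leq_trans _ qn)//.
  have a0 : 0 < a by rewrite invr_gt0 mulr_gt0// ltr0n.
  have y0 := lt_trans a0 ay.
  have y1 : y <= 1.
    rewrite (le_trans yb)// (le_trans _ qV)// lef_pV2 ?posrE ?mulr_gt0 ?ltr0n//.
    by rewrite ler_pM2r// ler_nat.
  have a1 : a <= 1 by rewrite (le_trans (ltW ay)).
  rewrite !fE ?a0 ?y0// -mulrBr normrM -!mulrA [leRHS]mulrCA ler_wpM2l// distrC.
  (* With N = k^3 and 1/a <= 16 k, the first part of the modulus is 1/(N a) <= 16/k^2 <= 32 w; the
     second is at most k^3 x = (k w)^3 w <= w. Doubling both gives 66 w. *)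
  have N0 : (0 < k ^ 3)%N by rewrite expn_gt0 k0.
  rewrite (le_trans (Rintegral_Kker_modulus a0 (ltW ay) y1 N0))//.
  rewrite mulrCA ler_wpM2l//.
  have h1 : ((k ^ 3)%:R * a)^-1 <= 32 * w.
    rewrite invfM invrK.
    have : n.+1%:R * x <= 16 * k%:R.
      by rewrite (le_trans _ px2)// ler_pM2r// ler_nat.
    move=> h; rewrite natrX.
    apply: (@le_trans _ _ (k%:R ^- 3 * (16 * k%:R))).
      by rewrite ler_wpM2l// invr_ge0 exprn_ge0.
    rewrite (_ : _ * _ = 16 * (k%:R^-1 * k%:R^-1)); last first.
      by field; rewrite gt_eqF// ltr0n.
    rewrite (_ : 32 * w = 16 * (2 * w)); last by ring.
    rewrite ler_wpM2l// (le_trans _ kV)// ler_piMr ?invr_ge0//.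
    by rewrite invf_le1// ltr0n.
  have h2 : a^-1 - y^-1 <= x.
    have : n%:R * x <= y^-1.
      by rewrite -[n%:R * x]invrK lef_pV2 ?posrE ?invr_gt0 ?mulr_gt0 ?ltr0n.
    by rewrite /a invrK -natr1; lra.
  have h3 : (k ^ 3)%:R * (a^-1 - y^-1) <= w.
    apply: (@le_trans _ _ ((k ^ 3)%:R * x)); first by rewrite ler_wpM2l.
    rewrite natrX -wx (_ : _ * _ = (k%:R * w) ^+ 3 * w); last by ring.
    by rewrite ler_piMl ?(ltW w0)// exprn_ile1// mulr_ge0// ltW.
  by rewrite -(mulrA 2); lra.
have b1 : (p%:R * x)^-1 <= 2 * w.
  by rewrite (le_trans _ kV)// lef_pV2 ?posrE ?(lt_trans _ px1) ?ltr0n// ltW.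
have b2 : 1 - (q%:R * x)^-1 <= w.
  rewrite (le_trans _ xw)// -(ler_pM2r (lt_le_trans ltr01 qx1)).
  rewrite mulrBl mulVf ?gt_eqF ?(lt_le_trans _ qx1)// mul1r.
  by rewrite (@le_trans _ _ x)// ?ler_peMr ?(ltW x0)//; lra.
apply: lerD; last exact: ler_wpM2l.
apply: lerD; first exact: ler_wpM2l.
by rewrite lerD2r ler_wpM2r.
Qed.

End KernelIntegral.

(** * Integrability of y^(-3/4) on [0, 1] *)

Section FourthRootIntegral.
Context {R : realType}.
Local Notation leb := (@lebesgue_measure R).

Lemma measurable_root4_div (A : set R) : measurable_fun A (fun y : R => root4 y / y).
Proof.
apply: (@measurable_funS _ _ _ _ setT) => //; apply: measurable_funM.
  exact: measurable_powR.
exact: measurable_invr.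
Qed.

Lemma integral_root4_div (e : R) : 0 < e -> e < 1 ->
  (\int[leb]_(y in `[e, 1%R]) (root4 y / y)%:E <= 4%:E)%E.
Proof.
move=> e0 e1; pose G (y : R) := 4 * root4 y.
have dG (y : R) : 0 < y -> is_derive y (1 : R) G (root4 y / y).
  move=> y0; have dr := is_derive_root4 y0; rewrite /G; apply: is_derive_eq.
  by rewrite /GRing.scale /= mulrA mulfV// mul1r.
have cG (y : R) : 0 < y -> {for y, continuous G}.
  move=> y0; apply: differentiable_continuous; apply/derivable1_diffP.
  by apply: ex_derive; exact: dG.
rewrite (@continuous_FTC2 _ _ G)//.
- rewrite -EFinB lee_fin /G (_ : root4 1 = 1); last by rewrite /root4 powR1.
  by have := root4_ge0 e; lra.
- apply: derivable_within_continuous => y; rewrite in_itv/= => /andP[ey _].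
  have y0 := lt_le_trans e0 ey; apply: derivableM.
    by apply: ex_derive; exact: is_derive_root4.
  by apply: derivableV; rewrite ?gt_eqF.
- split.
  + move=> y; rewrite in_itv/= => /andP[ey _].
    by apply: ex_derive; apply: dG; exact: lt_trans ey.
  + exact/cvg_at_right_filter/cG.
  + exact/cvg_at_left_filter/cG.
- move=> y; rewrite in_itv/= => /andP[ey _].
  by rewrite derive1E; have [_ ->] := dG y (lt_trans e0 ey).
Qed.

(** The antiderivative 4 y^(1/4) bounds the integral over [e, 1] by 4 for every e, and monotone
    convergence extends this bound to (0, 1]. *)
Lemma integrable_root4_div : leb.-integrable `[0, 1] (fun y => (root4 y / y)%:E).
Proof.
apply/integrableP; split; first by apply/measurable_EFinP; exact: measurable_root4_div.
rewrite -integral_itv_obnd_cbnd; last first.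
  apply/measurable_EFinP; apply: measurableT_comp => //; exact: measurable_root4_div.
rewrite (@eq_integral _ _ _ leb _ (fun y => (root4 y / y)%:E)); last first.
  move=> y; rewrite inE /= in_itv/= => /andP[y0 _].
  by rewrite ger0_norm// divr_ge0 ?root4_ge0// ltW.
(* The shift by 2 keeps the left end strictly below 1, as [integral_root4_div] requires. *)
pose F (n : nat) : set R := `[n.+2%:R^-1, 1]%classic.
have FU : `]0, 1]%classic = \bigcup_n F n.
  apply/seteqP; split=> y /=.
    rewrite in_itv/= => /andP[y0 y1]; exists (Num.truncn y^-1) => //=.
    rewrite /F /= in_itv/= y1 andbT -[leRHS]invrK lef_pV2 ?posrE ?invr_gt0//.
    rewrite (@le_trans _ _ (Num.truncn y^-1).+1%:R) ?ler_nat//.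
    by rewrite ltW// -truncn_le_nat.
  move=> [n _]; rewrite /F /= !in_itv/= => /andP[ny ->]; rewrite andbT.
  by rewrite (lt_le_trans _ ny)// invr_gt0.
have ndF : {homo F : n m / (n <= m)%N >-> (n <= m)%O}.
  move=> n m nm; apply/subsetPset => y; rewrite /F /= !in_itv/= => /andP[ny ->].
  by rewrite andbT (le_trans _ ny)// lef_pV2 ?posrE// ler_nat.
have cv : (\int[leb]_(y in F n) (root4 y / y)%:E)%E @[n --> \oo] -->
    (\int[leb]_(y in \bigcup_n F n) (root4 y / y)%:E)%E.
  apply: ge0_nondecreasing_set_cvg_integral => //.
  - by move=> n; exact: measurable_itv.
  - by move=> n; apply/measurable_EFinP; exact: measurable_root4_div.
  - move=> n y; rewrite /F /= in_itv/= => /andP[ny _].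
    by rewrite lee_fin divr_ge0 ?root4_ge0// (le_trans _ ny)// invr_ge0.
rewrite FU -(cvg_lim _ cv)//.
apply: (@le_lt_trans _ _ 4%:E); last exact: ltry.
apply: lime_le; first by apply/cvg_ex; eexists; exact: cv.
apply: nearW => n; apply: integral_root4_div; first by rewrite invr_gt0.
by rewrite invf_lt1 ?ltr1n.
Qed.

End FourthRootIntegral.

(** * The full series identity, its continuity and its derivative *)

Section Eigenfunction.
Context {R : realType} (f : R -> R) (M C lam : R).
Context (mf : measurable_fun [set: R] f) (fM : forall y : R, `|f y| <= M)
  (f0 : forall y : R, ~~ (0 < y <= 1) -> f y = 0)
  (fC : forall y : R, `|f y| <= C * root4 y) (C0 : 0 <= C).
Local Notation leb := (@lebesgue_measure R).
Local Notation J := (`]0, 1]%classic : set R).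
Context (fE : forall x : R, 0 < x <= 1 ->
  f x = lam * \int[leb]_(y in J) (Kker x y * f y)).
Implicit Types (s t x y : R) (m n N : nat).

Local Notation prim := (prim f).

Lemma prim_root4 s t : 0 <= s -> s <= t -> `|prim t - prim s| <= C * root4 t * (t - s).
Proof.
move=> s0 st; apply: (prim_lipschitz mf fM) => //.
  by rewrite mulr_ge0// root4_ge0.
move=> y /andP[sy yt]; rewrite (le_trans (fC y))// ler_wpM2l// ler_root4//.
exact: le_trans (ltW sy).
Qed.

Lemma prim_const t : 1 <= t -> prim t = prim 1.
Proof.
move=> t1; apply/eqP; rewrite -subr_eq0 -normr_le0.
rewrite -[leRHS](mul0r (t - 1)); apply: (prim_lipschitz mf fM) => //.
by move=> y /andP[y1 _]; rewrite f0 ?normr0// negb_and -ltNge y1 orbT.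
Qed.

Lemma prim_continuous t : 0 < t -> {for t, continuous prim}.
Proof.
move=> t0; apply/cvgrPdist_le => e e0.
have M0 : 0 <= M by exact: le_trans (fM 0).
near=> s.
have s0 : 0 < s by near: s; exact: lt_nbhsr.
have st : `|t - s| <= e / (M + 1).
  by near: s; apply: cvgr_dist_le; rewrite ?divr_gt0// ltr_wpDl.
have {}st : (M + 1) * `|t - s| <= e.
  by rewrite mulrC -ler_pdivlMr// ltr_wpDl.
apply: (le_trans _ st).
have h : `|prim t - prim s| <= M * `|t - s|.
  have [le_st|/ltW le_ts] := leP s t.
    rewrite (ger0_norm (_ : 0 <= t - s)) ?subr_ge0//.
    by apply: (prim_lipschitz mf fM) => //; exact: ltW.
  rewrite distrC (distrC t) (ger0_norm (_ : 0 <= s - t)) ?subr_ge0//.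
  by apply: (prim_lipschitz mf fM) => //; exact: ltW.
by rewrite (le_trans h)// ler_wpM2r// lerDl.
Unshelve. all: by end_near. Qed.

(** The m = 0 term is harmless: 0^-1 = 0 and F 0 = 0. *)
Definition primS x : R := limn (series (fun m => prim (m%:R * x)^-1)).

Definition root4_dominant (c : R) : nat -> R := fun m => c * (root4 m%:R^-1 / m%:R).

Lemma cvg_series_dom c : cvgn (series (root4_dominant c)).
Proof.
have := @is_cvg_seriesZ _ (fun m => root4 m%:R^-1 / m%:R : R) c.
by apply; exact: cvg_series_root4.
Qed.

(** Decay of f gives |F t| <= C t^(5/4); take t = 1/(m x). *)
Lemma prim_dom x m : 0 < x ->
  `|prim (m%:R * x)^-1| <= root4_dominant (C * (root4 x^-1 / x)) m.
Proof.
move=> x0; have mx : 0 <= (m%:R * x)^-1 by rewrite invr_ge0 mulr_ge0// ltW.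
have := prim_root4 (lexx 0) mx; rewrite prim0 !subr0 => /le_trans; apply.
rewrite invfM root4M ?invr_ge0// ?(ltW x0)//.
by rewrite /root4_dominant le_eqVlt; apply/orP; left; apply/eqP; ring.
Qed.

Lemma cvg_primS x : 0 < x -> cvgn (series (fun m => prim (m%:R * x)^-1)).
Proof.
move=> x0; have [//] := series_dominated (fun m => prim_dom m x0) (@cvg_series_dom _).
Qed.

(** Monotonicity in the base point lets the majorant at x/2 serve a whole neighbourhood of x. *)
Lemma dom_root4_le x y m : 0 < y -> y <= x ->
  root4_dominant (C * (root4 x^-1 / x)) m <= root4_dominant (C * (root4 y^-1 / y)) m.
Proof.
move=> y0 yx; have x0 := lt_le_trans y0 yx.
have xy : x^-1 <= y^-1 by rewrite lef_pV2.
rewrite /root4_dominant ler_wpM2r ?divr_ge0 ?root4_ge0// ler_wpM2l//.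
by rewrite ler_pM ?root4_ge0 ?invr_ge0 ?(ltW x0)// ler_root4// invr_ge0 ltW.
Qed.

Lemma primS_continuous x : 0 < x -> {for x, continuous primS}.
Proof.
move=> x0; pose y := x / 2; have y0 : 0 < y by rewrite divr_gt0.
have yx : y < x by rewrite /y; lra.
have cm m : prim (m%:R * t)^-1 @[t --> x] --> prim (m%:R * x)^-1.
  case: m => [|m].
    by under eq_cvg do rewrite mul0r invr0; rewrite mul0r invr0; exact: cvg_cst.
  have mx : 0 < m.+1%:R * x by rewrite mulr_gt0.
  apply: (@continuous_comp _ _ _ (fun t => (m.+1%:R * t)^-1) prim).
    apply: continuousV; first by rewrite gt_eqF.
    by apply: continuousM; [exact: cvg_cst|exact: cvg_id].
  by apply: prim_continuous; rewrite invr_gt0.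
have bm : \forall t \near x, forall m,
    `|prim (m%:R * t)^-1| <= root4_dominant (C * (root4 y^-1 / y)) m.
  near=> t => m; have yt : y < t by near: t; exact: lt_nbhsr.
  by rewrite (le_trans (prim_dom _ (lt_trans y0 yt)))// dom_root4_le// ltW.
by have [_] := cvg_series_dominated cm bm (@cvg_series_dom _).
Unshelve. all: by end_near. Qed.

Definition Phi : R := \int[leb]_(y in J) (f y / y).

Let measurable_fdiv (A : set R) : measurable_fun A (fun y => f y / y).
Proof.
apply: (@measurable_funS _ _ _ _ setT) => //; apply: measurable_funM => //.
exact: measurable_invr.
Qed.

Lemma integrable_fdiv : leb.-integrable J (fun y => (f y / y)%:E).
Proof.
have iJ : leb.-integrable J (fun y => (C * (root4 y / y))%:E).
  under [X in _.-integrable _ X]funext do rewrite EFinM.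
  apply: integrableZl => //.
  by apply: integrableS integrable_root4_div => //; exact: subset_itv_oc_cc.
apply: le_integrable iJ => //; first by apply/measurable_EFinP; exact: measurable_fdiv.
move=> y; rewrite /= in_itv/= => /andP[y0 _]; rewrite lee_fin.
rewrite normrM normfV (gtr0_norm y0) [leRHS]ger0_norm; last first.
  by rewrite !mulr_ge0 ?root4_ge0 ?invr_ge0// ltW.
by rewrite mulrA ler_wpM2r// invr_ge0 ltW.
Qed.

(** Dominated convergence with majorant |f y| / (x y), whose integrability is where the decay of f
    enters. *)
Lemma cvg_Rintegral_min x : 0 < x ->
  \int[leb]_(y in J) (Num.min (x * y)^-1 N%:R * f y) @[N --> \oo] --> x^-1 * Phi.
Proof.
move=> x0; rewrite /Phi -RintegralZl//; last exact: integrable_fdiv.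
have ifx : leb.-integrable J (fun y => (x^-1 * (f y / y))%:E).
  under [X in _.-integrable _ X]funext do rewrite EFinM.
  by apply: integrableZl => //; exact: integrable_fdiv.
apply: fine_cvg.
have mA (A : set R) : measurable_fun A (fun y => x^-1 * (f y / y)).
  exact: measurable_funM.
have mJ : measurable J by exact: measurable_itv.
have [|||||_ _ h] := @dominated_convergence _ _ _ leb J mJ
  (fun N y => (Num.min (x * y)^-1 N%:R * f y)%:E)
  (fun y => (x^-1 * (f y / y))%:E) (abse \o (fun y => (x^-1 * (f y / y))%:E)).
- move=> N; apply/measurable_EFinP; apply: (@measurable_funS _ _ _ _ setT) => //.
  apply: measurable_funM => //; apply: measurable_minr => //.
  by apply: (measurableT_comp measurable_invr); exact: measurable_funM.
- by apply/measurable_EFinP; exact: mA.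
- apply: aeW => y; rewrite /= in_itv/= => /andP[y0 y1].
  apply: cvg_near_cst; near=> N.
  rewrite min_l; first by rewrite invfM -mulrA (mulrC y^-1).
  by near: N; exact: nbhs_infty_ger.
- exact: integrable_abse.
- apply: aeW => y N; rewrite /= in_itv/= => /andP[y0 y1].
  have xy0 : 0 <= (x * y)^-1 by rewrite invr_ge0 mulr_ge0// ltW.
  rewrite lee_fin (_ : x^-1 * (f y / y) = (x * y)^-1 * f y); last first.
    by rewrite invfM mulrAC mulrA.
  rewrite !normrM (ger0_norm xy0) ler_wpM2r//.
  by rewrite ger0_norm ?ge_min ?lexx// le_min xy0 ler0n.
rewrite fineK//; exact: integrable_fin_num.
Unshelve. all: by end_near. Qed.

Lemma Rintegral_Kker_series x : 0 < x ->
  \int[leb]_(y in J) (Kker x y * f y) = 2^-1 * prim 1 - x^-1 * Phi + primS x.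
Proof.
move=> x0.
have c1 : \int[leb]_(y in J) (truncK N.+1 x y * f y) @[N --> \oo] -->
    \int[leb]_(y in J) (Kker x y * f y).
  apply/cvgrPdist_le => e e0; near=> N.
  rewrite (le_trans (Rintegral_Kker_truncK mf fM x0 (ltn0Sn N)))//.
  rewrite ler_pdivrMr ?mulr_gt0// mulrA -ler_pdivrMr// -ler_pdivrMl//.
  rewrite (@le_trans _ _ N%:R) ?ler_nat//.
  by near: N; exact: nbhs_infty_ger.
have c2 : \int[leb]_(y in J) (truncK N.+1 x y * f y) @[N --> \oo] -->
    2^-1 * prim 1 - x^-1 * Phi + primS x.
  (* The series runs to [N.+2] because its vanishing term m = 0 comes on top of the terms 1, ..., N
     + 1. *)
  have E N : \int[leb]_(y in J) (truncK N.+1 x y * f y) =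
      2^-1 * prim 1 - \int[leb]_(y in J) (Num.min (x * y)^-1 N.+1%:R * f y) +
      series (fun m => prim (m%:R * x)^-1) N.+2.
    rewrite (Rintegral_truncK mf fM f0)//; congr (_ + _).
    by rewrite /series /= [RHS]big_nat_recl//= mul0r invr0 prim0 add0r big_add1.
  under eq_cvg do rewrite E.
  apply: cvgD.
    apply: cvgB; first exact: cvg_cst.
    by have := cvg_Rintegral_min x0; rewrite -cvg_shiftS.
  by have := cvg_primS x0; rewrite /primS -cvg_shiftS -[X in X -> _]cvg_shiftS.
exact: cvg_unique c1 c2.
Unshelve. all: by end_near. Qed.

(* A continuous extension of [f] from (0, 1] to (0, +oo). *)
Definition eigen_ext x : R := lam * (2^-1 * prim 1 - x^-1 * Phi + primS x).

Lemma eigen_extE x : 0 < x <= 1 -> f x = eigen_ext x.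
Proof. by move=> x01; rewrite fE// Rintegral_Kker_series// (andP x01).1. Qed.

Lemma eigen_ext_continuous x : 0 < x -> {for x, continuous eigen_ext}.
Proof.
move=> x0; apply: continuousM; first exact: cvg_cst.
apply: continuousD; last exact: primS_continuous.
apply: continuousB; first exact: cvg_cst.
by apply: continuousM; [exact: inv_continuous (lt0r_neq0 x0)|exact: cvg_cst].
Qed.

(** The limit point may be 1, where f can jump because of the extension by zero; keeping [t y] at
    most 1 lets f be replaced by its continuous extension. *)
Lemma cvg_eigenfun (G : set_system R) {FG : ProperFilter G} (t : R -> R) (t0 : R) :
  t y @[y --> G] --> t0 -> 0 < t0 <= 1 -> (\forall y \near G, t y <= 1) ->
  f (t y) @[y --> G] --> f t0.
Proof.
move=> tt0 /andP[t00 t01] t1; rewrite eigen_extE ?t00//.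
have c : eigen_ext (t y) @[y --> G] --> eigen_ext t0.
  exact: (cvg_comp _ _ tt0 (@eigen_ext_continuous _ t00)).
apply: cvg_trans c; apply: near_eq_cvg; near=> y.
rewrite eigen_extE//; apply/andP; split; last by near: y.
by near: y; exact: (cvgr_gt _ tt0).
Unshelve. all: by end_near. Qed.

Lemma eigenfun_continuous x : 0 < x < 1 -> {for x, continuous f}.
Proof.
move=> /andP[x0 x1]; apply: (@cvg_eigenfun (nbhs x) _ id) => //; first by rewrite x0 ltW.
by near=> y; apply: ltW; near: y; exact: lt_nbhsl.
Unshelve. all: by end_near. Qed.

Lemma is_derive_prim t : 0 < t < 1 -> is_derive t (1 : R) prim (f t).
Proof.
move=> t01; have /andP[t0 t1] := t01.
have := @continuous_FTC1 _ f (BRight 0) t 1 t1 (integrable_f mf fM _ _).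
move=> /(_ t0 (eigenfun_continuous t01))[d1 d2].
by apply: DeriveDef; [exact: d1|rewrite -derive1E].
Qed.

(** The constant depends only on z, the common lower bound of the two points, and is summable in m:
    one factor 1/m comes from the length of the interval between the arguments of F, and m^(-1/4)
    from the decay of f there. *)
Lemma prim_term_lipschitz z u v m : 0 < z -> z <= u -> u <= v ->
  `|prim (m%:R * v)^-1 - prim (m%:R * u)^-1| <=
  root4_dominant (C * root4 z^-1 / (z * z)) m * (v - u).
Proof.
move=> z0 zu uv; have u0 := lt_le_trans z0 zu; have v0 := lt_le_trans u0 uv.
have mV : 0 <= m%:R^-1 :> R by rewrite invr_ge0.
have uvV : v^-1 <= u^-1 by rewrite lef_pV2.
have zuV : u^-1 <= z^-1 by rewrite lef_pV2.
rewrite (invfM _ v) (invfM _ u) distrC (le_trans (prim_root4 _ _))//.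
- by rewrite mulr_ge0// invr_ge0 ltW.
- by rewrite ler_wpM2l.
rewrite -mulrBr root4M ?invr_ge0// ?(ltW u0)//.
have -> : u^-1 - v^-1 = (v - u) / (u * v) by field; rewrite !gt_eqF.
have -> : C * (root4 m%:R^-1 * root4 u^-1) * (m%:R^-1 * ((v - u) / (u * v))) =
  C * (root4 u^-1 * (u * v)^-1) * (root4 m%:R^-1 / m%:R * (v - u)) by ring.
rewrite /root4_dominant -!mulrA ler_wpM2l// mulrA [leRHS]mulrA.
apply: ler_wpM2r.
  by rewrite !mulr_ge0 ?root4_ge0// subr_ge0.
apply: ler_pM; rewrite ?root4_ge0//.
- by rewrite invr_ge0 mulr_ge0// ltW.
- by rewrite ler_root4// invr_ge0 ltW.
by rewrite lef_pV2 ?posrE ?mulr_gt0// ler_pM// ?(ltW z0)// (le_trans zu).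
Qed.

(** For m x > 1 this is the chain rule. For m x < 1 the argument 1/(m x) exceeds 1, where F is
    constant. The case m x = 1, where F may have a corner, is excluded because 1/x is not an
    integer. *)
Lemma is_derive_prim_term x m : 0 < x < 1 -> x^-1 \isn't a Num.int ->
  is_derive x (1 : R) (fun y => prim (m%:R * y)^-1)
    (- x ^- 2 * (if x^-1 < m%:R then f (m%:R * x)^-1 / m%:R else 0)).
Proof.
move=> /andP[x0 x1] xZ; case: (ltP x^-1 m%:R) => xm.
  have m0 : 0 < m%:R :> R by rewrite (lt_trans _ xm)// invr_gt0.
  have mx0 : 0 < m%:R * x by rewrite mulr_gt0.
  have mx1 : (m%:R * x)^-1 < 1.
    rewrite invf_lt1//; move: xm; rewrite -(ltr_pM2r x0) mulVf// gt_eqF//.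
  have d1 : is_derive x (1 : R) (fun y : R => (m%:R * y)^-1) (- x ^- 2 / m%:R).
    have dm : is_derive x (1 : R) (fun y : R => m%:R * y) m%:R.
      by apply: is_derive_eq; rewrite /GRing.scale /= mulr1.
    have mxn0 : m%:R * x != 0 by rewrite gt_eqF.
    have := @is_deriveV _ (fun y : R => m%:R * y) x m%:R 1 mxn0 dm.
    move=> dV; apply: is_derive_eq; rewrite /GRing.scale /=.
    by field; rewrite !gt_eqF.
  have d2 : is_derive (m%:R * x)^-1 (1 : R) prim (f (m%:R * x)^-1).
    by apply: is_derive_prim; rewrite invr_gt0 mx0.
  have := @is_derive1_comp _ prim (fun y : R => (m%:R * y)^-1) x _ _ d2 d1.
  by move=> dc; apply: is_derive_eq; ring.
have {}xm : m%:R < x^-1.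
  rewrite lt_neqAle xm andbT; apply: contraNneq xZ => <-; exact: natr_int.
rewrite mulr0.
have E : \forall y \near x, prim (m%:R * y)^-1 = prim (m%:R * x)^-1.
  case: m xm => [|m] xm; first by near=> y; rewrite !mul0r.
  have mx1 : x < m.+1%:R^-1.
    by rewrite -[x]invrK ltf_pV2 ?posrE ?invr_gt0.
  have big y : 0 < y -> y < m.+1%:R^-1 -> prim (m.+1%:R * y)^-1 = prim 1.
    move=> y0 ym; apply: prim_const; rewrite invf_ge1 ?mulr_gt0//.
    by rewrite mulrC -ler_pdivlMr// mul1r ltW.
  near=> y; rewrite !big//; near: y; [exact: lt_nbhsr|exact: lt_nbhsl].
apply/is_derive_cvgP; apply: cvg_near_cst.
have c0 : t + x @[t --> (0 : R)] --> x.
  rewrite -[X in _ --> X]add0r.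
  by apply: cvgD; [exact: cvg_id|exact: cvg_cst].
have E0 : \forall t \near (0 : R), prim (m%:R * (t + x))^-1 = prim (m%:R * x)^-1.
  exact: (c0 _ E).
apply: (@nbhs_dnbhs _ (0 : R)); near=> t.
rewrite (_ : prim (m%:R * (t + x))^-1 = prim (m%:R * x)^-1) ?subrr ?mulr0//.
by near: t.
Unshelve. all: by end_near. Qed.

Lemma is_derive_eigenfun x : 0 < x < 1 -> x^-1 \isn't a Num.int ->
  let u m := if x^-1 < m%:R then f (m%:R * x)^-1 / m%:R else 0 in
  cvgn (series u) /\ is_derive x (1 : R) f (lam * x ^- 2 * (Phi - limn (series u))).
Proof.
move=> x01 xZ u; have /andP[x0 x1] := x01.
pose z := x / 2; have z0 : 0 < z by rewrite divr_gt0.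
have zx : z < x by rewrite /z; lra.
have lipm : \forall y \near x, forall m, `|prim (m%:R * y)^-1 - prim (m%:R * x)^-1| <=
    root4_dominant (C * root4 z^-1 / (z * z)) m * `|y - x|.
  near=> y => m; have zy : z <= y by apply: ltW; near: y; exact: lt_nbhsr.
  have [xy|/ltW yx] := leP x y.
    by rewrite (ger0_norm (_ : 0 <= y - x)) ?subr_ge0// prim_term_lipschitz// ltW.
  rewrite distrC (distrC y) (ger0_norm (_ : 0 <= x - y)) ?subr_ge0//.
  exact: prim_term_lipschitz.
have cvm : \forall y \near x, cvgn (series (fun m => prim (m%:R * y)^-1)).
  by near=> y; apply: cvg_primS; near: y; exact: lt_nbhsr.
have [cd dS] := is_derive_series (fun m => is_derive_prim_term m x01 xZ) cvm lipm
  (@cvg_series_dom _).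
(* The differentiated series is -x^(-2) times [series u], so its convergence is carried over by the
   factor -x^2. *)
have cu : cvgn (series u).
  have := @is_cvg_seriesZ _ _ (- x ^+ 2) cd; rewrite (_ : _ *: _ = u)//.
  apply/funext => m; rewrite -[LHS]/(- x ^+ 2 * (- x ^- 2 * u m)).
  by rewrite mulrA mulNr mulrN opprK mulfV ?mul1r// expf_neq0// gt_eqF.
split; first exact: cu.
have dSE : limn (series (fun m => - x ^- 2 *
      (if x^-1 < m%:R then f (m%:R * x)^-1 / m%:R else 0))) =
    - x ^- 2 * limn (series u) by exact: lim_seriesZ.
rewrite dSE in dS.
have xn0 : x != 0 by rewrite gt_eqF.
have dE : is_derive x (1 : R) eigen_ext (lam * x ^- 2 * (Phi - limn (series u))).
  have dV := @is_deriveV _ id x 1 1 xn0 (is_derive_id _ _).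
  rewrite /eigen_ext; apply: is_derive_eq; rewrite /GRing.scale /=.
  by field.
apply: near_eq_is_derive dE; near=> y; rewrite -eigen_extE//.
apply/andP; split; last apply: ltW; near: y.
  exact: lt_nbhsr.
exact: lt_nbhsl.
Unshelve. all: by end_near. Qed.

(** For x >= 1/(n + 1) the condition m > n no longer depends on x and still keeps 1/(m x) in (0, 1],
    while 1/x <= n + 1 makes the majorant uniform. The filter [G] allows interior points and
    one-sided limits at once. *)
Lemma cvg_eigen_series (G : set_system R) {FG : ProperFilter G} n (x0 : R) :
  G --> x0 -> n.+1%:R^-1 <= x0 -> (\forall x \near G, n.+1%:R^-1 <= x) ->
  let v x m := if (n < m)%N then f (m%:R * x)^-1 / m%:R else 0 in
  cvgn (series (v x0)) /\ limn (series (v x)) @[x --> G] --> limn (series (v x0)).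
Proof.
move=> Gx0 nx0 nG v.
have z0 : 0 < n.+1%:R^-1 :> R by rewrite invr_gt0.
have le1 m x : (n < m)%N -> n.+1%:R^-1 <= x -> 0 < (m%:R * x)^-1 <= 1.
  move=> nm nx; have m0 : 0 < m%:R :> R by rewrite ltr0n (leq_trans _ nm).
  have x0' := lt_le_trans z0 nx.
  rewrite invr_gt0 mulr_gt0//= invf_le1 ?mulr_gt0//.
  rewrite -[leLHS](@mulfV _ n.+1%:R) ?pnatr_eq0// ler_pM// ler_nat//.
apply: (@cvg_series_dominated _ _ G _ (fun m x => v x m) (v x0)
  (root4_dominant (C * root4 n.+1%:R))); last exact: cvg_series_dom.
- move=> m; rewrite /v; case: ifPn => nm; last exact: cvg_cst.
  apply: cvgM; last exact: cvg_cst.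
  apply: cvg_eigenfun => //; [|exact: le1|].
    apply: cvgV.
      by have /andP[] := le1 _ _ nm nx0; rewrite invr_gt0 => /lt0r_neq0.
    by apply: cvgM => //; exact: cvg_cst.
  by near=> x; have /andP[] : 0 < (m%:R * x)^-1 <= 1 by apply: le1 => //; near: x.
- near=> x => m; have nx : n.+1%:R^-1 <= x by near: x.
  have xV : x^-1 <= n.+1%:R by rewrite -[leRHS]invrK lef_pV2 ?posrE// (lt_le_trans z0).
  rewrite /v /root4_dominant; case: ifPn => nm; last by rewrite normr0 !mulr_ge0 ?root4_ge0.
  rewrite normrM (ger0_norm (_ : 0 <= m%:R^-1)) ?invr_ge0// mulrA ler_wpM2r ?invr_ge0//.
  rewrite (le_trans (fC _))// -mulrA ler_wpM2l// invfM.
  rewrite root4M ?invr_ge0 ?(le_trans (ltW z0) nx)//.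
  rewrite mulrC ler_wpM2r ?root4_ge0// ler_root4// invr_ge0.
  exact: le_trans (ltW z0) nx.
Unshelve. all: by end_near. Qed.

End Eigenfunction.

(** * Boundedness of eigenfunctions *)

Section EigenfunctionBound.
Context {R : realType}.
Local Notation leb := (@lebesgue_measure R).

(** The integrand is dominated by 1 + phi^2, independently of x, and the eigenfunction equation
    holds at every point, so the bound on the integral is a pointwise bound on [phi]. *)
Lemma eigenfun_bounded (phi : R -> R) (lam : R) : eigenfun phi lam ->
  (forall x : R, leb.-integrable (@I01 R) (EFin \o (fun y => Kker x y * phi y))) /\
  exists M : R, forall x : R, 0 <= x <= 1 -> `|phi x| <= M.
Proof.
move=> [[mphi iphi2] [_ phiE]].
have mI : measurable (@I01 R) by exact: measurable_itv.
have i1 : leb.-integrable (@I01 R) (EFin \o (fun y => 1 + phi y ^+ 2)).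
  have -> : EFin \o (fun y => 1 + phi y ^+ 2) =
      ((cst 1%E : R -> \bar R) \+ (fun y => (phi y ^+ 2)%:E)).
    by apply/funext => y /=; rewrite EFinD.
  apply: integrableD => //.
  apply: (@integrable_bounded _ _ (fun=> 1) 1) => //; last by rewrite normr1.
  by rewrite /I01 lebesgue_measure_itv/= lte_fin ltr01 -EFinB ltry.
have Kle x y : `|Kker x y * phi y| <= 1 + phi y ^+ 2.
  rewrite normrM (le_trans (ler_wpM2r _ (Kker_half x y)))//.
  rewrite -[phi y ^+ 2]real_normK ?num_real//.
  have := normr_ge0 (phi y); set a := `|phi y| => a0.
  (* Expanding the square gives a/2 <= a^2 + 1/16. *)
  by have := sqr_ge0 (a - 4^-1); rewrite sqrrB; lra.
have iK x : leb.-integrable (@I01 R) (EFin \o (fun y => Kker x y * phi y)).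
  apply: le_integrable i1 => //.
    by apply/measurable_EFinP; apply: measurable_funM => //; exact: measurable_Kker.
  move=> y _ /=; rewrite lee_fin [leRHS]ger0_norm//.
  by rewrite addr_ge0// sqr_ge0.
split=> //; exists (`|lam| * \int[leb]_(y in @I01 R) (1 + phi y ^+ 2)) => x x01.
rewrite phiE; last by rewrite /I01 /= in_itv.
rewrite normrM ler_wpM2l// (le_trans (le_normr_Rintegral _ (iK x)))//.
by apply: le_Rintegral => //; exact: integrable_norm.
Qed.

End EigenfunctionBound.

Theorem theorem4p1 (R : realType) (phis : nat -> R -> R) (lams : nat -> R)
  (Hsys : eigen_system phis lams) (j : nat) :
  let phi := phis j in
  let lam := lams j in
  let Phi1 := \int[@lebesgue_measure R]_(y in @I01 R) (phi y / y) in
  (@lebesgue_measure R).-integrable (@I01 R) (fun y => (phi y / y)%:E) /\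
  (forall x : R, 0 < x < 1 -> x^-1 \isn't a Num.int ->
     let u := fun m : nat => if x^-1 < m%:R then phi ((m%:R * x)^-1) / m%:R
                             else 0 in
     derivable phi x 1 /\ cvgn (series u) /\
     lam^-1 * x ^+ 2 * (derive1 phi) x = Phi1 - limn (series u)) /\
  (forall n : nat, (0 < n)%N ->
     let vl := fun m : nat => if (n < m)%N then phi (n%:R / m%:R) / m%:R
                              else 0 in
     let vr := fun m : nat => if (n < m)%N then phi (n.+1%:R / m%:R) / m%:R
                              else 0 in
     {in `](n.+1%:R)^-1, (n%:R)^-1[, continuous (derive1 phi)} /\
     cvgn (series vl) /\
     (derive1 phi) x @[x --> ((n%:R)^-1)^'-] -->
       lam * n%:R ^+ 2 * (Phi1 - limn (series vl)) /\
     cvgn (series vr) /\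
     (derive1 phi) x @[x --> ((n.+1%:R)^-1)^'+] -->
       lam * n.+1%:R ^+ 2 * (Phi1 - limn (series vr))).
Proof.
move=> phi lam Phi1.
have [lam0 ef] := Hsys.1 j; rewrite -/phi -/lam in lam0 ef.
have [iK [M phiM]] := eigenfun_bounded ef.
have [[mphi _] [_ phiE]] := ef.
pose leb := @lebesgue_measure R.
pose J : set R := `]0, 1]%classic.
(* The values of [phi] outside [0, 1] are arbitrary, so the analysis runs on this cut-off and
   returns to [phi] near interior points, where the two agree. *)
pose f : R -> R := phi \_ J.
have JI : J `<=` @I01 R by exact: subset_itv_oc_cc.
have fphi (y : R) : 0 < y <= 1 -> f y = phi y.
  by move=> y01; rewrite /f patchE mem_setE /J /= in_itv/= y01.
have f0 (y : R) : ~~ (0 < y <= 1) -> f y = 0.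
  by move=> /negbTE y01; rewrite /f patchE mem_setE /J /= in_itv/= y01.
have mf : measurable_fun [set: R] f.
  have mJ : measurable J by exact: measurable_itv.
  apply: (proj1 (measurable_restrictT phi mJ)).
  by apply: measurable_funS JI mphi; exact: measurable_itv.
have fM (y : R) : `|f y| <= M.
  have [y01|y01] := boolP (0 < y <= 1).
    by rewrite fphi// phiM// ltW ?(andP y01).2// (andP y01).1.
  by rewrite f0// normr0 (le_trans _ (phiM 0 _))// lexx ler01.
have fE (x : R) : 0 < x <= 1 -> f x = lam * \int[leb]_(y in J) (Kker x y * f y).
  move=> x01; rewrite fphi// phiE; last first.
    by rewrite /I01 /= in_itv/= (andP x01).2 ltW// (andP x01).1.
  congr (_ * _); rewrite /I01 -Rintegral_itv_obnd_cbnd; last first.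
    by apply: integrableS (iK x); [exact: measurable_itv..|exact: JI].
  by apply: eq_Rintegral => y; rewrite inE /= in_itv/= => y01; rewrite fphi.
pose C := `|lam| * M * (4 + 66 * `|lam|).
have fC := eigenfun_decay mf fM f0 fE; rewrite -/C in fC.
have C0 : 0 <= C.
  have M0 : 0 <= M by exact: le_trans (fM 0).
  by rewrite !mulr_ge0// addr_ge0// mulr_ge0.
have phi0 : phi 0 = 0.
  rewrite phiE; last by rewrite /I01 /= in_itv/= lexx ler01.
  rewrite [X in _ * X](_ : _ = \int[leb]_(y in @I01 R) 0).
    by rewrite Rintegral_cst ?mul0r ?mulr0//; exact: measurable_itv.
  by apply: eq_Rintegral => y _; rewrite /Kker mul0r eqxx mul0r.
have phi_div (y : R) : 0 <= y <= 1 -> `|phi y / y| <= `|C * (root4 y / y)|.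
  move=> /andP[]; rewrite le_eqVlt => /predU1P[<- _|y0 y1].
    by rewrite phi0 mul0r normr0.
  rewrite -fphi ?y0// normrM normfV (gtr0_norm y0) [leRHS]ger0_norm.
    by rewrite mulrA ler_wpM2r// invr_ge0 ltW.
  exact: (mulr_ge0 C0 (divr_ge0 (root4_ge0 y) (ltW y0))).
have iPhi : leb.-integrable (@I01 R) (fun y => (phi y / y)%:E).
  have iC : leb.-integrable (@I01 R) (fun y => (C * (root4 y / y))%:E).
    under [X in _.-integrable _ X]funext do rewrite EFinM.
    by apply: integrableZl => //; [exact: measurable_itv|exact: integrable_root4_div].
  apply: le_integrable iC => //; first exact: measurable_itv.
  apply/measurable_EFinP; apply: measurable_funM => //.
  by apply: measurable_funS measurable_invr.
have PhiE : Phi1 = Phi f.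
  rewrite /Phi1 /I01 -Rintegral_itv_obnd_cbnd; last first.
    by apply: integrableS iPhi; [exact: measurable_itv..|exact: JI].
  by apply: eq_Rintegral => y; rewrite inE /= in_itv/= => y01; rewrite fphi.
have near_phi (x : R) : 0 < x < 1 -> \forall y \near x, f y = phi y.
  move=> /andP[x0 x1]; near=> y; apply: fphi; apply/andP; split; near: y.
    exact: lt_nbhsr.
  exact: lt_le_nbhsl.
have dphi (x : R) : 0 < x < 1 -> x^-1 \isn't a Num.int ->
    let u := fun m : nat => if x^-1 < m%:R then phi (m%:R * x)^-1 / m%:R else 0 in
    cvgn (series u) /\ is_derive x (1 : R) phi (lam * x ^- 2 * (Phi1 - limn (series u))).
  move=> x01 xZ u; have /andP[x0 x1] := x01.
  have [] := is_derive_eigenfun mf fM f0 fC C0 fE x01 xZ.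
  set u' := fun m : nat => _; have -> : u' = u.
    apply/funext => m; rewrite /u' /u; case: ifPn => // xm.
    have m0 : 0 < m%:R :> R by rewrite (lt_trans _ xm)// invr_gt0.
    rewrite fphi// invr_gt0 mulr_gt0//= invf_le1 ?mulr_gt0//.
    by rewrite -ler_pdivrMr// mul1r ltW.
  rewrite PhiE => cu df; split; first exact: cu.
  by apply: near_eq_is_derive df; exact: near_phi.
split; first exact: iPhi.
split.
  move=> x x01 xZ u; have [cu [dx dxE]] := dphi x x01 xZ.
  have x0 : x != 0 by rewrite gt_eqF// (andP x01).1.
  split; first exact: dx.
  split; first exact: cu.
  rewrite derive1E dxE.
  by field; rewrite lam0 x0.
move=> n n0 vl vr.
have n0' : 0 < n%:R :> R by rewrite ltr0n.
pose v (x : R) (m : nat) : R := if (n < m)%N then f (m%:R * x)^-1 / m%:R else 0.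
(* Here 1/x lies strictly between n and n + 1, so it is not an integer and m > 1/x means m > n. *)
have dE (x : R) : n.+1%:R^-1 < x < n%:R^-1 ->
    derive1 phi x = lam * x ^- 2 * (Phi1 - limn (series (v x))).
  move=> /andP[nx xn].
  have x0 : 0 < x by rewrite (lt_trans _ nx)// invr_gt0.
  have nV : n%:R < x^-1 by rewrite -[ltLHS]invrK ltf_pV2 ?posrE ?invr_gt0.
  have Vn : x^-1 < n.+1%:R by rewrite -[ltRHS]invrK ltf_pV2 ?posrE ?invr_gt0.
  have x01 : 0 < x < 1.
    by rewrite x0 (lt_le_trans xn)// invf_le1// ler1n.
  have xm m : (x^-1 < m%:R) = (n < m)%N.
    apply/idP/idP => [xm|nm]; first by rewrite -(ltr_nat R) (lt_trans nV).
    by rewrite (lt_le_trans Vn)// ler_nat.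
  have xZ : x^-1 \isn't a Num.int.
    apply/negP => /intrP[i iE]; move: nV Vn; rewrite iE.
    rewrite -[n%:R]/(n%:Z%:~R) -[n.+1%:R]/(n.+1%:Z%:~R) !ltr_int.
    by case: i {iE} => // i; rewrite !ltz_nat ltnS => /leq_trans/[apply]; rewrite ltnn.
  have [_ [_ dxE]] := dphi x x01 xZ; rewrite derive1E dxE.
  rewrite [X in series X](_ : _ = v x)//; apply/funext => m; rewrite /v xm.
  case: ifPn => // nm; have m0 : 0 < m%:R :> R by rewrite ltr0n (leq_trans _ nm).
  rewrite fphi// invr_gt0 mulr_gt0//= invf_le1 ?mulr_gt0//.
  by rewrite -ler_pdivrMr// mul1r ltW// xm.
(* Stated for a filter, this yields the continuity of the derivative and both one-sided limits. *)
have dcvg (G : set_system R) (FG : ProperFilter G) (x0 : R) :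
    G --> x0 -> n.+1%:R^-1 <= x0 -> (\forall x \near G, n.+1%:R^-1 < x < n%:R^-1) ->
    cvgn (series (v x0)) /\
    derive1 phi x @[x --> G] --> lam * x0 ^- 2 * (Phi1 - limn (series (v x0))).
  move=> Gx0 nx0 nG.
  have nG' : \forall x \near G, n.+1%:R^-1 <= x.
    by apply: filterS nG => x /andP[/ltW].
  have x00 : x0 != 0 by rewrite gt_eqF// (lt_le_trans _ nx0)// invr_gt0.
  have [cv lv] := cvg_eigen_series mf fM f0 fC C0 fE Gx0 nx0 nG'.
  split=> //.
  have c : lam * x ^- 2 * (Phi1 - limn (series (v x))) @[x --> G] -->
      lam * x0 ^- 2 * (Phi1 - limn (series (v x0))).
    apply: cvgM; last by apply: cvgB => //; exact: cvg_cst.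
    apply: cvgM; first exact: cvg_cst.
    apply: cvgV; first by rewrite expf_neq0.
    by under eq_cvg do rewrite expr2; rewrite expr2; exact: cvgM.
  apply: cvg_trans c; apply: near_eq_cvg; near=> x.
  by rewrite dE//; near: x.
have nn : n.+1%:R^-1 < n%:R^-1 :> R by rewrite ltf_pV2 ?posrE// ltr_nat.
have vlE : vl = v n%:R^-1.
  apply/funext => m; rewrite /vl /v; case: ifPn => // nm.
  have m0 : 0 < m%:R :> R by rewrite ltr0n (leq_trans _ nm).
  have -> : (m%:R / n%:R)^-1 = n%:R / m%:R :> R by rewrite invfM invrK mulrC.
  by rewrite fphi// divr_gt0//= ler_pdivrMr// mul1r ler_nat ltnW.
have vrE : vr = v n.+1%:R^-1.
  apply/funext => m; rewrite /vr /v; case: ifPn => // nm.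
  have m0 : 0 < m%:R :> R by rewrite ltr0n (leq_trans _ nm).
  have -> : (m%:R / n.+1%:R)^-1 = n.+1%:R / m%:R :> R by rewrite invfM invrK mulrC.
  by rewrite fphi// divr_gt0//= ler_pdivrMr// mul1r ler_nat.
split.
  move=> x; rewrite in_itv/= => nx; have /andP[nx1 nx2] := nx.
  have [||_] := dcvg (nbhs x) _ x _ (ltW nx1) => //.
    near=> y; apply/andP; split; near: y; [exact: lt_nbhsr|exact: lt_nbhsl].
  by rewrite -dE.
rewrite vlE vrE.
have [] := dcvg (n%:R^-1)^'- _ n%:R^-1.
- exact: cvg_within.
- exact: ltW.
- near=> y; apply/andP; split; near: y; last exact: nbhs_left_lt.
  exact: nbhs_left_gt.
move=> cl ll; split=> //; split; first by move: ll; rewrite exprVn invrK.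
have [] := dcvg (n.+1%:R^-1)^'+ _ n.+1%:R^-1.
- exact: cvg_within.
- exact: lexx.
- near=> y; apply/andP; split; near: y; first exact: nbhs_right_gt.
  exact: nbhs_right_lt.
by move=> cr lr; split=> //; move: lr; rewrite exprVn invrK.
Unshelve. all: by end_near. Qed.
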